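(* Let $n$ be a positive integer. Then $$\sum_{0 \le k_1 < \dots < k_n} R^{\ast}_{(k_{1},\ldots,k_{n})}(x_{1},\ldots,x_{n};1,1,w)=\prod_{i=1}^n \frac{1}{1-x_i} \prod_{1 \le i < j \le n} \frac{x_i+x_j+w x_i x_j}{x_j-x_i}\ \operatorname{Pf}_{\chi_{\mathrm{even}}(n) \le i < j \le n} \left(\begin{cases}1, & i=0,\\ \frac{(x_j-x_i)(1+(1+w) x_i x_j)}{(x_i+x_j+w x_i x_j)(1-x_i x_j)},& i\ge 1\end{cases} \right),$$ where the sum is over all strictly increasing sequences of $n$ nonnegative integers.
   Context: For a sequence of integers $\boldsymbol{k}=(k_1,\dots,k_n)$, the modified Robbins polynomial is $$R_{\boldsymbol{k}}^{\ast}(x_{1},\ldots,x_{n};u,v,w)=\frac{\mathbf{ASym}_{x_{1},\ldots,x_{n}}\left[\prod_{1\le i<j\le n}(u x_{i}x_{j}+v+w x_{i})\prod_{i=1}^{n}x_{i}^{k_{i}}\right]}{\prod_{1\le i<j\le n}(x_{j}-x_{i})},$$ where $\mathbf{ASym}_{x_1,\ldots,x_n} F(x_1,\dots,x_n)=\sum_{\sigma\in\mathfrak S_n}\operatorname{sgn}(\sigma)F(x_{\sigma(1)},\dots,x_{\sigma(n)})$. $\chi_{\mathrm{even}}(n)$ equals $1$ if $n$ is even and $0$ if $n$ is odd. So the Pfaffian is over the index set $\{1,\dots,n\}$ for $n$ even and $\{0,1,\dots,n\}$ for $n$ odd. The Pfaffian of a triangular array $(a_{i,j})_{1\le i<j\le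 2m}$ is $\sum \operatorname{sgn}(i_1j_1\dots i_mj_m)\,a_{i_1,j_1}\cdots a_{i_m,j_m}$, summed over all perfect matchings $\{(i_1,j_1),\dots,(i_m,j_m)\}$ of $\{1,\dots,2m\}$ with $i_1<\dots<i_m$ and $i_k<j_k$ for all $k$; for index sets $\{0,\dots,2m-1\}$ one relabels in increasing order. The variables $x_1,\dots,x_n,w$ are indeterminates, and the infinite sum is understood as a formal power series in $x_1,\dots,x_n$; the right-hand side is a rational function expanded as such a power series. *)

(* Defs.v *)
From mathcomp Require Import all_boot all_order all_fingroup all_algebra.
From mathcomp Require Export fraction.
From mathcomp.multinomials Require Export mpoly.

Set Implicit Arguments.
Unset Strict Implicit.
Unset Printing Implicit Defensive.

Import GRing.Theory.
Local Open Scope ring_scope.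

(* Indices are shifted by one: x_1, ..., x_n are x 0, ..., x (n - 1) for
   x : 'I_n -> K, and likewise for k_1, ..., k_n. *)

Definition asym (K : fieldType) (n : nat) (f : ('I_n -> K) -> K)
    (x : 'I_n -> K) : K :=
  \sum_(s : 'S_n) (-1) ^+ s * f (fun i => x (s i)).

Definition robbins (K : fieldType) (n : nat) (k : 'I_n -> int)
    (x : 'I_n -> K) (u v w : K) : K :=
  asym (fun y => (\prod_(i < n) \prod_(j < n | (i < j)%N)
                     (u * y i * y j + v + w * y i))
                 * \prod_(i < n) y i ^ k i) x
  / \prod_(i < n) \prod_(j < n | (i < j)%N) (x j - x i).

Lemma double_ord_subproof (m : nat) (k : 'I_m) : (k.*2 < m.*2)%N.
Proof. by rewrite ltn_double. Qed.

Lemma doubleS_ord_subproof (m : nat) (k : 'I_m) : (k.*2.+1 < m.*2)%N.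
Proof. by rewrite ltn_Sdouble. Qed.

Definition evn (m : nat) (k : 'I_m) : 'I_m.*2 :=
  Ordinal (double_ord_subproof k).
Definition odn (m : nat) (k : 'I_m) : 'I_m.*2 :=
  Ordinal (doubleS_ord_subproof k).

(* The perfect matching {(i_1,j_1), ..., (i_m,j_m)} is represented by the
   permutation s whose one-line notation is the word i_1 j_1 ... i_m j_m. *)
Definition matching_word (m : nat) (s : 'S_m.*2) : bool :=
  [forall k : 'I_m, (s (evn k) < s (odn k))%N] &&
  [forall k : 'I_m, forall l : 'I_m,
     (k < l)%N ==> (s (evn k) < s (evn l))%N].

Definition pfaffian (K : fieldType) (m : nat) (a : 'I_m.*2 -> 'I_m.*2 -> K)
    : K :=
  \sum_(s : 'S_m.*2 | matching_word s)
    (-1) ^+ s * \prod_(k < m) a (s (evn k)) (s (odn k)).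

Definition chi_even (n : nat) : nat := ~~ odd n.

(* Pf_(b <= i < j <= n) a i j, for an index set {b, ..., n} of even size. *)
Definition pfaffian_range (K : fieldType) (b n : nat)
    (a : 'I_n.+1 -> 'I_n.+1 -> K) : K :=
  @pfaffian K (n.+1 - b)./2%N
    (fun i j => a (inord (b + i)%N) (inord (b + j)%N)).

(* Pfaffian indices run over {0, ..., n}; unlift ord0 sends 0 to None and
   i >= 1 to Some (i - 1), the position of x_i. *)
Definition pf_entry (K : fieldType) (n : nat) (x : 'I_n -> K) (w : K)
    (i j : 'I_n.+1) : K :=
  match unlift ord0 i, unlift ord0 j with
  | Some i', Some j' =>
      (x j' - x i') * (1 + (1 + w) * x i' * x j')
      / ((x i' + x j' + w * x i' * x j') * (1 - x i' * x j'))
  | _, _ => 1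
  end.

Definition littlewood_rhs (K : fieldType) (n : nat) (x : 'I_n -> K) (w : K)
    : K :=
  \prod_(i < n) (1 - x i)^-1
  * (\prod_(i < n) \prod_(j < n | (i < j)%N)
       ((x i + x j + w * x i * x j) / (x j - x i)))
  * pfaffian_range (chi_even n) (pf_entry x w).

(* Formal power series in n variables, as coefficient functions. *)
Definition fps (n : nat) (R : Type) : Type := 'X_{1..n} -> R.

Definition fps_mul (n : nat) (R : comNzRingType) (f g : fps n R) : fps n R :=
  fun m => \sum_(d : 'X_{1..n < (mdeg m).+1} | (d <= m)%MM)
             f d * g (m - d)%MM.

Definition fps_of_mpoly (n : nat) (R : comNzRingType) (p : {mpoly R[n]})
    : fps n R :=
  fun m => p@_m.

(* f = p / q with q invertible as a power series, and S = p * q^-1. *)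
Definition expands_to (n : nat) (R : idomainType)
    (f : {fraction {mpoly R[n]}}) (S : fps n R) : Prop :=
  exists p q : {mpoly R[n]},
    [/\ q@_0%MM \is a GRing.unit,
        f = tofrac p / tofrac q &
        forall m, fps_mul (fps_of_mpoly q) S m = fps_of_mpoly p m].

(* Summability for formal power series: every coefficient receives only
   finitely many nonzero contributions. *)
Definition fps_sum_is (n : nat) (R : comNzRingType) (I : eqType) (P : pred I)
    (F : I -> fps n R) (S : fps n R) : Prop :=
  forall m : 'X_{1..n}, exists s : seq I,
    [/\ uniq s, all P s,
        forall i, P i -> i \notin s -> F i m = 0 &
        S m = \sum_(i <- s) F i m].

(* {fraction {mpoly {poly int}[n]}} is the field Q(w, x_1, ..., x_n);
   power series in the x_i have coefficients in Z[w]. *)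
Definition ratfun (n : nat) : fieldType := {fraction {mpoly {poly int}[n]}}.

Definition var_x (n : nat) (i : 'I_n) : ratfun n :=
  tofrac ('X_i : {mpoly {poly int}[n]}).

Definition var_w (n : nat) : ratfun n :=
  tofrac (('X : {poly int})%:MP_[n]).

(* Main.v *)
Require Import Defs.
From mathcomp Require Import all_boot all_order all_fingroup all_algebra.
From mathcomp Require Import ring.
Import GRing.Theory.
Local Open Scope ring_scope.

Set Implicit Arguments.
Unset Strict Implicit.
Unset Printing Implicit Defensive.

(** A strictly increasing sequence k of exponents is determined by its gaps, so
    the sum of the monomials x^k is a product of geometric series,
    prod_i x_i^(i-1) / (1 - x_i x_(i+1) ... x_n).  The left-hand side is thus
    L(x) / prod_(i<j) (x_j - x_i), where L is the antisymmetrisation of an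
    explicit rational function.  The factor 1 / (1 - x_1 ... x_n) is symmetric;
    sorting the permutations by the variable b which they put first gives
      (1 - prod x) L(x)
        = sum_b +- prod_(y <> b) y (1 + y b + w b) L(x without b),
    with signs alternating along the list x ([asym_gap_weight]).

    Writing P(x) for the Pfaffian of the theorem, the identity amounts to
    L(x) = prod_i 1/(1 - x_i) prod_(i<j) (x_i + x_j + w x_i x_j) P(x), and by
    induction on n this follows from ([bordered_pf_rec])
      (1 - prod x) P(x)
        = sum_b +- (1 - b) prod_(y <> b) (y (1 + y b + w b) / (y + b + w y b))
                   P(x without b).
    This is a sum of residues.  Let F(z) be the Pfaffian obtained by adding a
    variable z to x, together with the row of ones when n is even.  As F
    vanishes at each x_i (two equal rows), the function
    F(z) prod_i (1 - x_i z) / (z - x_i) has no poles but the points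
    x_i' = - x_i / (1 + w x_i), where x_i + z + w x_i z vanishes.  Multiply it
    by dz / (z (z - 1)).  Up to a common factor, the residue at x_i' is the summand
    b = x_i, where 1 - b comes from the numerator 1 + (1 + w) x_i z of the
    Pfaffian entry.  At z = 0 the entries pairing z with the x_i are all 1 and at
    z = 1 they are all -1, and up to sign and the same common factor the residues
    there are P(x) and prod x P(x).  There is no residue at infinity.  The residue theorem is used in the
    form of Lagrange interpolation ([lagrange_sum]).

    It remains to pass to power series.  An antisymmetrised polynomial is a
    multiple of the Vandermonde product ([alternant_dvd]), and dividing by that
    product lowers the order of vanishing at the origin by at most its number
    of factors ([order_ge_divided]).  So a given coefficient receives
    contributions from finitely many k only.  The right-hand side has the
    symmetric common denominator [tails_sym], whose constant term is 1, and its
    product with the truncated sums agrees with the numerator of the right-hand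
    side to any prescribed order ([tails_sym_truncation]). *)

(** * Alternating sums and Pfaffians over lists *)

(** The signed expansion of a Pfaffian along a row, and of a sum over permutations
    by the value put first: [f b r] is summed over the ways to extract an entry [b]
    of [s], leaving [r], with sign (-1)^i for the entry of rank i.  Recursion on
    the list avoids all arithmetic on positions. *)
Fixpoint altsum (T : Type) (V : zmodType) (f : T -> seq T -> V) (s : seq T) : V :=
  if s is b :: s' then f b s' - altsum (fun c r => f c (b :: r)) s' else 0.

Lemma eq_altsum T (V : zmodType) (f g : T -> seq T -> V) s :
  (forall b r, f b r = g b r) -> altsum f s = altsum g s.
Proof.
elim: s f g => //= b s IH f g fg; rewrite fg; congr (_ - _); exact: IH.
Qed.

Lemma eq_altsum_split T (V : zmodType) (f g : T -> seq T -> V) s :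
  (forall u b v, s = u ++ b :: v -> f b (u ++ v) = g b (u ++ v)) ->
  altsum f s = altsum g s.
Proof.
elim: s f g => //= b s IH f g fg.
rewrite (fg [::] b s erefl); congr (_ - _).
by apply: IH => u c v Ds; apply: (fg (b :: u)); rewrite Ds.
Qed.

Lemma eq_altsum_in (T : eqType) (V : zmodType) (f g : T -> seq T -> V) s :
  (forall b r, perm_eq (b :: r) s -> subseq r s -> f b r = g b r) ->
  altsum f s = altsum g s.
Proof.
move=> fg; apply: eq_altsum_split => u b v Ds; apply: fg; rewrite Ds.
  by rewrite perm_sym -cat1s perm_catCA.
by rewrite cat_subseq ?subseq_cons.
Qed.

Lemma altsumD T (V : zmodType) (f g : T -> seq T -> V) s :
  altsum (fun b r => f b r + g b r) s = altsum f s + altsum g s.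
Proof.
elim: s f g => [|b s IH] f g /=; first by rewrite addr0.
by rewrite IH opprD addrACA.
Qed.

Lemma altsumN T (V : zmodType) (f : T -> seq T -> V) s :
  altsum (fun b r => - f b r) s = - altsum f s.
Proof.
elim: s f => [|b s IH] f /=; first by rewrite oppr0.
by rewrite IH opprD.
Qed.

Lemma altsum0 T (V : zmodType) (s : seq T) : altsum (fun _ _ => 0 : V) s = 0.
Proof. by elim: s => //= b s ->; rewrite subr0. Qed.

Lemma altsumZ T (V : pzRingType) (a : V) (f : T -> seq T -> V) s :
  altsum (fun b r => a * f b r) s = a * altsum f s.
Proof.
elim: s f => [|b s IH] f /=; first by rewrite mulr0.
by rewrite IH mulrBr.
Qed.

Lemma altsum_map T U (h : T -> U) (V : zmodType) (f : U -> seq U -> V) s :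
  altsum f (map h s) = altsum (fun b r => f (h b) (map h r)) s.
Proof. by elim: s f => [|b s IH] f //=; rewrite IH. Qed.

(** Extracting b then c and extracting c then b come with opposite signs. *)
Lemma altsum_sym T (V : zmodType) (g : T -> T -> seq T -> V) s :
  (forall b c r, g b c r = g c b r) ->
  altsum (fun b r => altsum (fun c r' => g b c r') r) s = 0.
Proof.
elim: s g => //= b s IH g gC.
under eq_altsum => c r do rewrite gC.
by rewrite altsumD altsumN IH ?subr0 ?subrr // => c d r; exact: gC.
Qed.

(** The terms extracting [a] or [b] are exchanged, with opposite signs, and in the
    others [a] and [b] are still adjacent. *)
Lemma altsum_swap T (V : zmodType) (f : T -> seq T -> V) a b u v :
  (forall d u' v', f d (u' ++ a :: b :: v') = - f d (u' ++ b :: a :: v')) ->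
  altsum f (u ++ a :: b :: v) = - altsum f (u ++ b :: a :: v).
Proof.
elim: u f => [|c u IH] f fab /=.
  have -> : altsum (fun c r => f c (a :: b :: r)) v =
            - altsum (fun c r => f c (b :: a :: r)) v.
    by rewrite -altsumN; apply: eq_altsum => c r; rewrite (fab c [::]).
  by rewrite !opprB addrA.
rewrite fab IH ?opprD // => d u' v'; exact: (fab d (c :: u')).
Qed.

Section Pf.
Variables (T : Type) (K : comPzRingType) (e : T -> T -> K).

(** The Pfaffian of the entries [e] over a list of length 2m, by expansion along
    the first row.  It is 0 on lists of other lengths, so that exchanging two
    indices changes the sign whatever the length. *)
Fixpoint pfseq (m : nat) (s : seq T) : K :=
  match m, s with
  | 0, _ => (nilp s)%:R
  | _.+1, [::] => 0
  | m'.+1, a :: s' => altsum (fun b r => e a b * pfseq m' r) s'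
  end.

Hypothesis e_skew : forall a b, e a b = - e b a.
Hypothesis e_diag : forall a, e a a = 0.

(** Swapping the first two indices exchanges the order in which their partners are
    extracted, up to a term symmetric in the partners; further down the list one
    expands along the first row. *)
Lemma pfseq_swap m u a b v :
  pfseq m (u ++ a :: b :: v) = - pfseq m (u ++ b :: a :: v).
Proof.
elim: m u v => [|m IH] [|c u] v /=; rewrite ?oppr0 //; last first.
  by apply: altsum_swap => d u' v'; rewrite IH mulrN.
case: m {IH} => [|m] /=.
  rewrite (e_skew b a) mulNr opprD !opprK; congr (_ + _).
  under eq_altsum do rewrite mulr0.
  by under [in RHS]eq_altsum do rewrite mulr0; rewrite altsum0 oppr0.
rewrite (e_skew b a) mulNr opprD !opprK; congr (_ + _).
apply/eqP; rewrite -subr_eq0 -opprD oppr_eq0 -altsumD; apply/eqP.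
under eq_altsum => c r do rewrite -!altsumZ -altsumD.
by apply: altsum_sym => c d r; rewrite addrC mulrCA [X in _ + X]mulrCA.
Qed.

Lemma pfseq_head2 m a r : pfseq m (a :: a :: r) = 0.
Proof.
case: m => [|[|m]] //=; rewrite e_diag mul0r add0r.
  by under eq_altsum do rewrite mulr0; rewrite altsum0 oppr0.
by under eq_altsum do rewrite -altsumZ; rewrite altsum_sym ?oppr0 // => b c s; rewrite mulrCA.
Qed.

(** Adjacent swaps bring the two equal indices together at the head of the list.
    No division by 2 is involved, since the entries vanish on the diagonal. *)
Lemma pfseq_repeat m a u v : pfseq m (a :: u ++ a :: v) = 0.
Proof.
elim/last_ind: u v => [|u c IH] v; first exact: pfseq_head2.
by rewrite cat_rcons (pfseq_swap _ (a :: u)) IH oppr0.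
Qed.
End Pf.

(** * Expansion of the Pfaffian of matchings along its first row *)

(** A permutation is the image of 0 together with a bijection between the
    complements of 0 and of that image. *)
Lemma sum_lift_perm (V : nmodType) n (F : 'S_n.+1 -> V) :
  \sum_s F s = \sum_(j < n.+1) \sum_(s : 'S_n) F (lift_perm ord0 j s).
Proof.
rewrite (partition_big (fun s : 'S_n.+1 => s ord0) predT) //=.
apply: eq_bigr => j _; rewrite (reindex (lift_perm ord0 j)) /=.
  by apply: eq_bigl => s; rewrite lift_perm_id eqxx.
pose rest (s : 'S_n.+1) k := odflt k (unlift (s ord0) (s (lift ord0 k))).
have restK (s : 'S_n.+1) k : lift (s ord0) (rest s k) = s (lift ord0 k).
  rewrite /rest; have := neq_lift ord0 k.
  by rewrite -(can_eq (permK s)) => /unlift_some[] ? ? ->.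
have rest_inj s : injective (rest s).
  move=> k l /(congr1 (lift (s ord0))); rewrite !restK.
  by move/perm_inj/lift_inj.
exists (fun s => perm (rest_inj s)) => [s _ | s].
  by apply/permP=> k; rewrite permE /rest lift_perm_lift lift_perm_id liftK.
rewrite inE => /eqP sj; apply/permP=> k.
case: (unliftP ord0 k) => [k'|] ->; rewrite ?lift_perm_id //.
by rewrite lift_perm_lift -sj permE restK.
Qed.

Lemma altsum_ord T (V : pzRingType) n (f : T -> seq T -> V) (t : 'I_n.+1 -> T) :
  altsum f [seq t i | i <- enum 'I_n.+1] =
  \sum_(j < n.+1) (-1) ^+ j * f (t j) [seq t (lift j i) | i <- enum 'I_n].
Proof.
elim: n f t => [|n IH] f t.
  by rewrite enum_ordSl big_ord_recl big_ord0 /= enum_ord0 /= mul1r subr0 addr0.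
rewrite enum_ordSl big_ord_recl /= mul1r -map_comp IH -sumrN; congr (_ + _).
apply: eq_bigr => j _; rewrite exprS mulN1r mulNr; congr (- (_ * f _ _)).
rewrite [in RHS]enum_ordSl /= -map_comp; congr (t _ :: _).
  by apply: val_inj.
by apply: eq_map => i /=; congr t; apply: val_inj; rewrite /= /bump !add1n ltnS addnS.
Qed.

(** The word of a matching starts with its least letter 0 and the partner of 0;
    deleting these two letters gives the word of a matching of the other indices. *)
Lemma pfaffian_rec (K : fieldType) m (a : 'I_m.*2.+2 -> 'I_m.*2.+2 -> K) :
  @pfaffian K m.+1 a =
  \sum_(j < m.*2.+1) (-1) ^+ j * (a ord0 (lift ord0 j) *
    @pfaffian K m (fun i k => a (lift ord0 (lift j i)) (lift ord0 (lift j k)))).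
Proof.
have ev0 : @evn m.+1 ord0 = ord0 :> 'I_m.*2.+2 by apply: val_inj.
have od0 : @odn m.+1 ord0 = lift ord0 ord0 :> 'I_m.*2.+2 by apply: val_inj.
have evS k : @evn m.+1 (lift ord0 k) = lift ord0 (lift ord0 (evn k)) :> 'I_m.*2.+2.
  by apply: val_inj.
have odS k : @odn m.+1 (lift ord0 k) = lift ord0 (lift ord0 (odn k)) :> 'I_m.*2.+2.
  by apply: val_inj.
rewrite /pfaffian big_mkcond /= (@sum_lift_perm _ m.*2.+1) big_ord_recl.
rewrite [X in _ + X]big1 ?addr0 => [|j _]; last first.
  rewrite big1 // => s _; case: ifP => // /andP[/forallP wo /forallP we].
  set p := lift_perm _ _ _ in wo we.
  have p0 : p ord0 = lift ord0 j by rewrite /p lift_perm_id.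
  pose i := (p^-1)%g ord0; have pi : p i = ord0 by rewrite permKV.
  have i0 : i != ord0.
    by apply/eqP => i0; move: pi; rewrite i0 p0 => /(congr1 val).
  have ihalf : ((i : nat)./2 < m.+1)%N.
    by rewrite ltn_half_double; apply: ltn_ord.
  pose k := Ordinal ihalf.
  have := odd_double_half i; case: (odd i) => /= Di.
    have odk : odn k = i by apply: val_inj; rewrite /= -[RHS]Di.
    by have := wo k; rewrite odk pi.
  have evk : evn k = i by apply: val_inj; rewrite /= -[in RHS]Di.
  have := forallP (we ord0) k; rewrite evk pi ltn0 implybF.
  have -> // : (0 < val k)%N.
  rewrite /= lt0n; apply: contraNneq i0 => k0.
  by apply/eqP/val_inj; rewrite /= -Di k0.
rewrite (@sum_lift_perm _ m.*2); apply: eq_bigr => j _.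
rewrite big_distrr big_distrr /= [RHS]big_mkcond /=; apply: eq_bigr => s _.
set p : 'S_m.*2.+2 := lift_perm _ _ _.
have p0 : p ord0 = ord0 by rewrite /p lift_perm_id.
have p1 : p (lift ord0 ord0) = lift ord0 j by rewrite /p lift_perm_lift lift_perm_id.
have pS i : p (lift ord0 (lift ord0 i)) = lift ord0 (lift j (s i)).
  by rewrite /p !lift_perm_lift.
have lt_lift (i k : 'I_m.*2) : 
  ((lift ord0 (lift j i) : 'I_m.*2.+2) < (lift ord0 (lift j k) : 'I_m.*2.+2))%N
    = (i < k)%N.
  by rewrite /= /bump !add1n ltnS [LHS]ltnNge [RHS]ltnNge leq_bump2.
have -> : @matching_word m.+1 p = matching_word s.
  apply/andP/andP => -[/forallP wo /forallP we]; split; apply/forallP => k.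
  - by have := wo (lift ord0 k); rewrite evS odS !pS lt_lift.
  - apply/forallP => l; have := forallP (we (lift ord0 k)) (lift ord0 l).
    by rewrite !evS !pS lt_lift /= /bump !add1n ltnS.
  - case: (unliftP ord0 k) => [k'|] ->; first by rewrite evS odS !pS lt_lift.
    by rewrite ev0 od0 p0 p1.
  - apply/forallP => l; apply/implyP.
    case: (unliftP ord0 l) => [l'|] ->; last by rewrite ltn0.
    case: (unliftP ord0 k) => [k'|] -> kl; last by rewrite ev0 evS p0 pS.
    rewrite !evS !pS lt_lift; apply: (implyP (forallP (we k') l')).
    by move: kl; rewrite /= /bump !add1n ltnS.
case: ifP => // _; rewrite big_ord_recl ev0 od0 p0 p1.
have -> : (-1) ^+ p = (-1) ^+ j * (-1) ^+ s :> K.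
  by rewrite /p odd_lift_perm addFb odd_lift_perm addFb signr_addb signr_odd.
rewrite -mulrA [_ * (a _ _ * _)]mulrCA; congr (_ * (_ * (_ * _))).
by apply: eq_bigr => k _; rewrite evS odS !pS.
Qed.

Lemma pfaffian_pfseq (K : fieldType) (T : Type) (e : T -> T -> K) m (t : 'I_m.*2 -> T) :
  @pfaffian K m (fun i j => e (t i) (t j)) = pfseq e m [seq t i | i <- enum 'I_m.*2].
Proof.
elim: m t => [|m IH] t.
  rewrite /pfaffian /= enum_ord0 (eq_bigl xpredT) => [|s]; last first.
    by apply/andP; split; apply/forallP => -[].
  rewrite (big_pred1 1%g) => [|s]; first by rewrite odd_perm1 big_ord0 mulr1.
  by apply/esym/eqP/permP => -[].
rewrite pfaffian_rec (@enum_ordSl m.*2.+1) /= -map_comp altsum_ord.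
by apply: eq_bigr => j _; rewrite (IH (fun i => t (lift ord0 (lift j i)))).
Qed.

Lemma eq_pfaffian (K : fieldType) m (a b : 'I_m.*2 -> 'I_m.*2 -> K) :
  (forall i j : 'I_m.*2, (i < j)%N -> a i j = b i j) -> pfaffian a = pfaffian b.
Proof.
move=> ab; apply: eq_bigr => s /andP[/forallP wo _]; congr (_ * _).
by apply: eq_bigr => k _; apply: ab.
Qed.

(** * Lagrange interpolation *)

Lemma altsum_sum T (V : zmodType) (I : Type) (l : seq I) (F : I -> T -> seq T -> V) s :
  \sum_(i <- l) altsum (F i) s = altsum (fun b r => \sum_(i <- l) F i b r) s.
Proof.
elim: l => [|i l IH].
  by rewrite big_nil -[LHS](altsum0 _ s); apply: eq_altsum => b r; rewrite big_nil.
by rewrite big_cons IH -altsumD; apply: eq_altsum => b r; rewrite big_cons.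
Qed.

Lemma raddf_altsum T (U V : zmodType) (h : {additive U -> V}) (f : T -> seq T -> U) s :
  h (altsum f s) = altsum (fun b r => h (f b r)) s.
Proof. by elim: s f => [|b s IH] f /=; rewrite ?raddf0 // raddfB IH. Qed.

Lemma size_altsum T (R : nzRingType) (f : T -> seq T -> {poly R}) d s :
  (forall b r, (size r).+1 = size s -> (size (f b r) <= d)%N) ->
  (size (altsum f s) <= d)%N.
Proof.
elim: s f => [|b s IH] f fd /=; first by rewrite size_poly0.
rewrite (leq_trans (size_polyD _ _)) // geq_max fd //= size_polyN.
by apply: IH => c r rs; apply: fd; rewrite /= rs.
Qed.

(** The sum is the coefficient of degree [size ps - 1] of the interpolation
    polynomial of N, which is N itself.  It is the algebraic form of the vanishing
    of the sum of residues of N(z) dz / prod_p (z - p). *)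
Lemma lagrange_sum (F : fieldType) (ps : seq F) (N : {poly F}) :
  uniq ps -> (size N < size ps)%N ->
  \sum_(p <- ps) N.[p] / \prod_(q <- ps | q != p) (p - q) = 0.
Proof.
move=> ups sN; pose D p := \prod_(q <- ps | q != p) (p - q).
pose M p := \prod_(q <- ps | q != p) ('X - q%:P).
have sM p : p \in ps -> size (M p) = size ps.
  move=> pps; rewrite /M -big_filter size_prod_XsubC -(rem_filter p ups).
  by rewrite size_rem // prednK //; case: (ps) pps.
have D0 p : D p != 0.
  by rewrite prodf_seq_neq0; apply/allP => q _; apply/implyP; rewrite subr_eq0 eq_sym.
pose L := \sum_(p <- ps) (N.[p] / D p) *: M p.
have NL : N - L = 0.
  apply: (@roots_geq_poly_eq0 _ _ ps) => //; last first.
    rewrite (leq_trans (size_polyD _ _)) // geq_max (ltnW sN) size_polyN.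
    apply: (leq_trans (size_sum _ _ _)); apply/bigmax_leqP_seq => p pps _.
    by rewrite (leq_trans (size_scale_leq _ _)) // sM.
  apply/allP => p pps; rewrite /root hornerD hornerN horner_sum (bigD1_seq p) //=.
  rewrite hornerZ [X in _ * _ + X]big1 ?addr0 => [|q qp]; last first.
    rewrite hornerZ /M horner_prod (big_rem p) //= eq_sym qp.
    by rewrite hornerXsubC subrr mul0r mulr0.
  rewrite /M horner_prod; under eq_bigr do rewrite hornerXsubC.
  by rewrite -/(D p) mulfVK ?subrr.
have /(congr1 (fun p : {poly F} => p`_(size ps).-1)) : N = L by apply/eqP; rewrite -subr_eq0 NL.
rewrite nth_default ?coef_sum => [L0|]; last by rewrite -ltnS prednK //; case: (ps) sN.
apply: etrans (esym L0).
apply: eq_big_seq => p pps; rewrite coefZ -(sM p pps).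
suff -> : (M p)`_(size (M p)).-1 = 1 by rewrite mulr1.
by apply/monicP; rewrite /M monic_prod // => q _; rewrite monicXsubC.
Qed.

(** * The sum of residues *)

Section PartialFractions.
Variables (K : fieldType) (w : K).

(** The zero in z of x + z + w x z, the point written x' in the introduction. *)
Definition conj_pt (x : K) : K := - x / (1 + w * x).
Definition schur_entry (a b : K) : K :=
  (b - a) * (1 + (1 + w) * a * b) / ((a + b + w * a * b) * (1 - a * b)).
(** The factor produced by y when b is extracted, once the antisymmetrisation is
    divided by the product of the x_i + x_j + w x_i x_j. *)
Definition pick_ratio (y b : K) : K :=
  y * (1 + y * b + w * b) / (y + b + w * y * b).

(** The conditions under which no denominator of the identity vanishes and the
    interpolation nodes x_i, x_i', 0, 1 are distinct. *)
Definition generic (xs : seq K) : Prop :=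
  [/\ uniq xs,
      {in xs, forall x, [/\ x != 0, x != 1, 1 + w * x != 0 & 1 + x + w * x != 0]},
      {in xs &, forall x y, x + y + w * x * y != 0} &
      {in xs &, forall x y, 1 - x * y != 0}].

Lemma subseq_generic xs ys : subseq ys xs -> generic xs -> generic ys.
Proof.
move=> yx [ux x0 xy0 xy1]; have sub := mem_subseq yx.
split=> [|y /sub/x0 //|x y /sub xx /sub|x y /sub xx /sub]; first exact: subseq_uniq ux.
- exact: xy0.
- exact: xy1.
Qed.

Lemma conj_ptB a x : 1 + w * x != 0 ->
  a - conj_pt x = (a + x + w * a * x) / (1 + w * x).
Proof. by move=> x0; rewrite /conj_pt; field. Qed.

(** Contribution of y <> b to the residue at b'. *)
Lemma conj_pt_ratio y b : y != b -> y != 0 -> 1 + w * y != 0 -> 1 + w * b != 0 ->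
  y + b + w * y * b != 0 ->
  ((y + conj_pt b + w * y * conj_pt b) * (1 - y * conj_pt b)) /
    ((conj_pt b - y) * (conj_pt b - conj_pt y)) =
  - ((1 + w * y) / y) * pick_ratio y b.
Proof.
move=> yb y0 wy wb yb0; rewrite /conj_pt /pick_ratio.
have yb' : y - b != 0 by rewrite subr_eq0.
have -> : y + - b / (1 + w * b) + w * y * (- b / (1 + w * b)) =
          (y - b) / (1 + w * b) by field.
have -> : - b / (1 + w * b) - y = - (y + b + w * y * b) / (1 + w * b) by field.
have -> : - b / (1 + w * b) - - y / (1 + w * y) = (y - b) / ((1 + w * b) * (1 + w * y)).
  by field; rewrite wy wb.
by field; rewrite ?y0 ?wy ?wb ?yb' ?yb0 ?oppr_eq0.
Qed.

(** Contribution of b itself to the residue at b'. *)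
Lemma conj_pt_residue b : b != 0 -> 1 + w * b != 0 -> 1 + b + w * b != 0 ->
  b + b + w * b * b != 0 ->
  ((b - conj_pt b) * (1 + (1 + w) * b * conj_pt b)) /
    ((conj_pt b - b) * (conj_pt b * (conj_pt b - 1))) =
  - ((1 + w * b) / b) * (1 - b).
Proof.
move=> b0 wb wb1 bb.
have -> : b - conj_pt b = (b + b + w * b * b) / (1 + w * b) by rewrite conj_ptB.
have -> : conj_pt b - b = - (b + b + w * b * b) / (1 + w * b).
  by rewrite -opprB conj_ptB // mulNr.
have -> : conj_pt b - 1 = - (1 + b + w * b) / (1 + w * b) by rewrite /conj_pt; field.
have -> : 1 + (1 + w) * b * conj_pt b = (1 - b) * (1 + b + w * b) / (1 + w * b).
  by rewrite /conj_pt; field.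
rewrite /conj_pt; field.
by rewrite !oppr_eq0 b0 wb wb1 bb.
Qed.

Lemma prod_notin (p : K) (ps : seq K) (f : K -> K) :
  p \notin ps -> \prod_(q <- ps | q != p) f q = \prod_(q <- ps) f q.
Proof.
move=> pps; rewrite big_mkcond; apply: eq_big_seq => q qps.
by case: eqP => // qp; rewrite -qp qps in pps.
Qed.

Lemma size_linear (a c : K) : (size (a%:P + c *: 'X : {poly K})%R <= 2)%N.
Proof.
rewrite (leq_trans (size_polyD _ _)) // geq_max (leq_trans (size_polyC_leq1 _)) //.
by rewrite (leq_trans (size_scale_leq _ _)) // size_polyX.
Qed.

Lemma size_mulleq (p q : {poly K}) i j :
  (size p <= i.+1)%N -> (size q <= j.+1)%N -> (size (p * q)%R <= (i + j).+1)%N.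
Proof.
move=> pi qj; rewrite (leq_trans (size_polyMleq _ _)) //.
by have := leq_add pi qj; rewrite addSn addnS; case: (_ + _)%N.
Qed.

(** The common denominator of the entries which involve the extra variable z. *)
Definition clearing (z : K) (ys : seq K) : K :=
  \prod_(y <- ys) ((y + z + w * y * z) * (1 - y * z)).

(** The sum of residues described in the introduction, for F given by an expansion
    along the row of z.  The polynomial N is F with its denominators cleared, of
    degree at most 2n, and the interpolation nodes are the 2n + 2 points x_i,
    x_i', 0 and 1.  It vanishes at the x_i; at b' only the extraction of b
    survives, as every other term keeps the factor b + z + w b z. *)
Lemma partial_fractions (c0 : K) (G : seq K -> K) xs
    (F := fun z => c0 + altsum (fun b r => schur_entry z b * G r) xs) :
  generic xs -> (forall x, x \in xs -> F x = 0) ->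
  altsum (fun b r => (1 - b) * \prod_(y <- r) pick_ratio y b * G r) xs =
  F 0 - (-1) ^+ size xs * \prod_(x <- xs) x * F 1.
Proof.
move=> [uxs x0 xy0 xy1] F0.
pose gh (y : K) : {poly K} := (y%:P + (1 + w * y) *: 'X) * (1%:P + (- y) *: 'X).
pose q (b : K) : {poly K} := (b%:P + (- 1) *: 'X) * (1%:P + ((1 + w) * b) *: 'X).
pose ghs ys := \prod_(y <- ys) gh y.
pose N := c0 *: ghs xs + altsum (fun b r => G r *: (q b * ghs r)) xs.
have ghE z ys : (ghs ys).[z] = clearing z ys.
  rewrite /ghs horner_prod; apply: eq_bigr => y _.
  by rewrite /gh hornerM !hornerD !hornerC !hornerZ hornerX; congr (_ * _); ring.
have qE z b : (q b).[z] = (b - z) * (1 + (1 + w) * z * b).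
  by rewrite /q hornerM !hornerD !hornerC !hornerZ hornerX; congr (_ * _); ring.
have NE z : N.[z] = c0 * clearing z xs
    + altsum (fun b r => G r * ((b - z) * (1 + (1 + w) * z * b) * clearing z r)) xs.
  rewrite /N hornerD hornerZ ghE; congr (_ + _).
  rewrite -[LHS]/(horner_eval z _) raddf_altsum; apply: eq_altsum => b r /=.
  by rewrite /horner_eval hornerZ hornerM qE ghE.
have NF z : {in xs, forall y, y + z + w * y * z != 0} ->
    {in xs, forall y, 1 - y * z != 0} -> N.[z] = F z * clearing z xs.
  move=> z0 z1; rewrite NE /F [RHS]mulrDl; congr (_ + _).
  rewrite [RHS]mulrC -altsumZ; apply: eq_altsum_in => b r pbr _.
  have bxs : b \in xs by rewrite -(perm_mem pbr) mem_head.
  rewrite [clearing z xs]/clearing -(perm_big _ pbr) big_cons /= -/(clearing z r).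
  have b0 : z + b + w * z * b != 0.
    by have := z0 _ bxs; rewrite [b + z]addrC -mulrA [b * z]mulrC mulrA.
  have b1 : 1 - z * b != 0 by rewrite mulrC z1.
  by rewrite /schur_entry; field; rewrite b0 b1.
have sN : (size N <= (size xs).*2.+1)%N.
  have sgh ys : (size (ghs ys) <= (size ys).*2.+1)%N.
    elim: ys => [|y ys IH]; first by rewrite /ghs big_nil size_poly1.
    rewrite /ghs big_cons /= doubleS -(add2n _.*2); apply: size_mulleq => //.
    by apply: (@size_mulleq _ _ 1 1); apply: size_linear.
  rewrite (leq_trans (size_polyD _ _)) // geq_max; apply/andP; split.
    by rewrite (leq_trans (size_scale_leq _ _)) ?sgh.
  apply: size_altsum => b r <-; rewrite (leq_trans (size_scale_leq _ _)) //.
  rewrite doubleS -(add2n _.*2); apply: size_mulleq; last exact: sgh.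
  by apply: (@size_mulleq _ _ 1 1); apply: size_linear.
pose ps := xs ++ map conj_pt xs ++ [:: 0; 1].
have wx x : x \in xs -> 1 + w * x != 0 by case/x0.
have conj_nin x y : x \in xs -> y \in xs -> y != conj_pt x.
  by move=> xx yx; rewrite -subr_eq0 conj_ptB ?wx // mulf_neq0 ?xy0 ?invr_eq0 ?wx.
have conj0 x : x \in xs -> conj_pt x != 0.
  by move=> /x0[? _ ? _]; rewrite /conj_pt mulf_neq0 ?oppr_eq0 ?invr_eq0.
have conj1 x : x \in xs -> conj_pt x != 1.
  move=> /x0[_ _ ? ?]; rewrite eq_sym -subr_eq0 conj_ptB // mulr1.
  by rewrite mulf_neq0 ?invr_eq0.
have conj_inj : {in xs &, injective conj_pt}.
  move=> x y xx yx /eqP; rewrite -subr_eq0 conj_ptB ?wx // mulf_eq0 invr_eq0.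
  rewrite (negPf (wx _ yx)) orbF => E; apply/eqP; move: E.
  have -> : conj_pt x + y + w * conj_pt x * y = (y - x) / (1 + w * x).
    by rewrite /conj_pt; field; exact: wx.
  by rewrite mulf_eq0 invr_eq0 (negPf (wx _ xx)) orbF subr_eq0 eq_sym.
have xs0 : 0 \notin xs by apply/negP => /x0[]; rewrite eqxx.
have xs1 : 1 \notin xs by apply/negP => /x0[_]; rewrite eqxx.
have cj0 : 0 \notin map conj_pt xs.
  by apply/mapP => -[x /conj0 + x0']; rewrite -x0' eqxx.
have cj1 : 1 \notin map conj_pt xs.
  by apply/mapP => -[x /conj1 + x1']; rewrite -x1' eqxx.
have ups : uniq ps.
  rewrite /ps !cat_uniq uxs map_inj_in_uniq // uxs /= !inE !orbF.
  rewrite (negPf cj0) (negPf cj1) eq_sym oner_neq0 !andbT /=.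
  rewrite has_cat /= (negPf xs0) (negPf xs1) !orbF ?andbT.
  by apply/hasPn => _ /mapP[x xx ->]; apply/negP => /(conj_nin x _ xx); rewrite eqxx.
pose D p := \prod_(q <- ps | q != p) (p - q).
have D0 : D 0 = \prod_(y <- xs) (- y * - conj_pt y) * - 1.
  rewrite /D !big_cat /= 2?prod_notin // big_map !big_cons big_nil eqxx oner_neq0 mulr1.
  by rewrite mulrA -big_split /= sub0r; congr (_ * _); apply: eq_bigr => y _; rewrite !sub0r.
have D1 : D 1 = \prod_(y <- xs) ((1 - y) * (1 - conj_pt y)).
  rewrite /D !big_cat /= 2?prod_notin // big_map !big_cons big_nil eqxx eq_sym oner_neq0.
  by rewrite subr0 !mulr1 -big_split.
have DE b r : perm_eq (b :: r) xs -> D (conj_pt b) =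
    (conj_pt b - b) * (conj_pt b * (conj_pt b - 1)) *
    \prod_(y <- r) ((conj_pt b - y) * (conj_pt b - conj_pt y)).
  move=> pbr; have bxs : b \in xs by rewrite -(perm_mem pbr) mem_head.
  have /andP[br ur] : uniq (b :: r) by rewrite (perm_uniq pbr).
  rewrite /D !big_cat /= prod_notin; last first.
    by apply/negP => /(conj_nin b _ bxs); rewrite eqxx.
  rewrite -(perm_big _ pbr) big_cons big_map -(perm_big _ pbr) big_cons /= eqxx /=.
  rewrite !big_cons big_nil eq_sym (conj0 b bxs) eq_sym (conj1 b bxs) subr0 mulr1.
  have -> : \prod_(y <- r | conj_pt y != conj_pt b) (conj_pt b - conj_pt y) =
            \prod_(y <- r) (conj_pt b - conj_pt y).
    rewrite big_mkcond; apply: eq_big_seq => y yr; case: eqP => // yb.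
    have yxs : y \in xs by rewrite -(perm_mem pbr) in_cons yr orbT.
    by rewrite -(conj_inj _ _ yxs bxs yb) yr in br.
  by rewrite big_split /=; ring.
(* Each x contributes the factor 1 / x' = - (1 + w x) / x to the terms of the
   nodes 0 and b', so U is common to all of them. *)
pose U := \prod_(x <- xs) - ((1 + w * x) / x).
have U0 : U != 0.
  rewrite prodf_seq_neq0; apply/allP => x xx /=; have [? _ _ _] := x0 x xx.
  by rewrite oppr_eq0 mulf_neq0 ?invr_eq0 ?wx.
pose T b r := (1 - b) * \prod_(y <- r) pick_ratio y b * G r.
have Nconj x : x \in xs -> N.[conj_pt x] / D (conj_pt x) =
    altsum (fun b r => (b == x)%:R * (U * T b r)) xs.
  move=> xx; rewrite NE.
  have kill ys : x \in ys -> clearing (conj_pt x) ys = 0.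
    move=> xys; rewrite /clearing (big_rem x) //=.
    suff -> : x + conj_pt x + w * x * conj_pt x = 0 by rewrite !mul0r.
    by rewrite /conj_pt; field; exact: wx.
  rewrite kill // mulr0 add0r mulrC -altsumZ; apply: eq_altsum_in => b r pbr _.
  have [bx|bx] := eqVneq b x; last first.
    rewrite kill ?mulr0 ?mul0r //.
    by move: xx; rewrite -(perm_mem pbr) in_cons eq_sym (negPf bx).
  have bxs : b \in xs by rewrite bx.
  have /andP[br ur] : uniq (b :: r) by rewrite (perm_uniq pbr).
  rewrite -bx (DE _ _ pbr) mul1r /U -(perm_big _ pbr) big_cons /= /T.
  have [b0 _ wb wb1] := x0 b bxs.
  have -> : clearing (conj_pt b) r =
     \prod_(y <- r) ((conj_pt b - y) * (conj_pt b - conj_pt y)) *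
     (\prod_(y <- r) - ((1 + w * y) / y) * \prod_(y <- r) pick_ratio y b).
    rewrite -!big_split /=; apply: eq_big_seq => y yr.
    have yxs : y \in xs by rewrite -(perm_mem pbr) in_cons yr orbT.
    have yb : y != b by apply: contraNneq br => <-.
    have [y0 _ wy _] := x0 y yxs.
    rewrite -conj_pt_ratio // ?xy0 // [RHS]mulrC mulfVK //.
    rewrite mulf_neq0 // subr_eq0; first by rewrite eq_sym conj_nin.
    by apply: contraNneq yb => /(conj_inj _ _ bxs yxs) ->.
  rewrite (mulrAC (1 + w) (conj_pt b)).
  have := conj_pt_residue b0 wb wb1 (xy0 _ _ bxs bxs).
  set n1 := (b - _) * _; set d1 := _ * (_ * _) => E.
  have d10 : d1 != 0.
    apply: mulf_neq0; first by rewrite subr_eq0 eq_sym conj_nin.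
    by apply: mulf_neq0; [exact: conj0 | rewrite subr_eq0 conj1].
  have d20 : \prod_(y <- r) ((conj_pt b - y) * (conj_pt b - conj_pt y)) != 0.
    rewrite prodf_seq_neq0; apply/allP => y yr /=.
    have yxs : y \in xs by rewrite -(perm_mem pbr) in_cons yr orbT.
    have yb : y != b by apply: contraNneq br => <-.
    rewrite mulf_neq0 // subr_eq0; first by rewrite eq_sym conj_nin.
    by apply: contraNneq yb => /(conj_inj _ _ bxs yxs) ->.
  have -> : n1 = - ((1 + w * b) / b) * (1 - b) * d1 by rewrite -E mulfVK.
  by field; rewrite b0 d10 d20.
have : \sum_(p <- xs ++ map conj_pt xs ++ [:: 0; 1]) N.[p] / D p = 0.
  apply: lagrange_sum => //.
  by rewrite !size_cat size_map /= addnA addnn addn2 ltnS.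
rewrite !big_cat big_map /= !big_cons big_nil addr0.
rewrite big1_seq => [|x /andP[_ xx]]; last first.
  by rewrite NF ?F0 ?mul0r // => y yxs; rewrite ?xy0 ?xy1.
rewrite add0r (eq_big_seq _ Nconj) altsum_sum.
have -> : altsum (fun b r => \sum_(x <- xs) (b == x)%:R * (U * T b r)) xs =
          U * altsum T xs.
  rewrite -altsumZ; apply: eq_altsum_in => b r pbr _.
  have bxs : b \in xs by rewrite -(perm_mem pbr) mem_head.
  rewrite (bigD1_seq b) //= eqxx mul1r big1 ?addr0 // => x bx.
  by rewrite eq_sym (negPf bx) mul0r.
have D0' : \prod_(y <- xs) (- y * - conj_pt y) != 0.
  rewrite prodf_seq_neq0; apply/allP => y yr /=; have [y0 _ _ _] := x0 y yr.
  by apply: mulf_neq0; rewrite oppr_eq0 ?conj0.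
have -> : N.[0] / D 0 = - (U * F 0).
  rewrite NF => [|y /x0[y0 *]|y _]; rewrite ?mulr0 ?addr0 ?subr0 ?oner_neq0 //.
  suff -> : clearing 0 xs = U * \prod_(y <- xs) (- y * - conj_pt y)
    by rewrite D0; field; rewrite oppr_eq0 oner_neq0 D0'.
  rewrite -big_split; apply: eq_big_seq => y /x0[y0 _ wy _] /=.
  by rewrite /conj_pt; field; rewrite y0 wy.
have D1' : \prod_(y <- xs) ((1 - y) * (1 - conj_pt y)) != 0.
  rewrite prodf_seq_neq0; apply/allP => y yr /=; have [_ y1 _ _] := x0 y yr.
  by apply: mulf_neq0; rewrite subr_eq0 eq_sym ?conj1.
have -> : N.[1] / D 1 = U * ((-1) ^+ size xs * \prod_(x <- xs) x * F 1).
  rewrite NF => [|y /x0[_ _ _]|y /x0[_ + _ _]].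
  - suff -> : clearing 1 xs = U * ((-1) ^+ size xs * \prod_(x <- xs) x) * 
      \prod_(y <- xs) ((1 - y) * (1 - conj_pt y)) by rewrite D1; field.
    have -> : (-1) ^+ size xs * \prod_(x <- xs) x = \prod_(x <- xs) - x.
      by elim: (xs) => [|x s IH]; rewrite ?big_nil ?mulr1 // !big_cons -IH exprS /=; ring.
    rewrite -!big_split; apply: eq_big_seq => y /x0[y0 _ wy _] /=.
    by rewrite /conj_pt; field; rewrite y0 wy.
  - by rewrite mulr1 [y + 1]addrC.
  - by rewrite mulr1 subr_eq0 eq_sym.
rewrite -mulrN -!mulrDr => /eqP; rewrite mulf_eq0 (negPf U0) /= => /eqP E.
by apply/subr0_eq; rewrite -[RHS]E opprB addrA addrAC -/T; ring.
Qed.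
End PartialFractions.

(** * The recursion for the Pfaffian *)

Section ClosedForm.
Variables (K : fieldType) (w : K).

(** [None] is the index 0 of the row of ones, here completed to a skew-symmetric
    matrix. *)
Definition bordered_entry (a b : option K) : K :=
  match a, b with
  | Some x, Some y => schur_entry w x y
  | None, Some _ => 1
  | Some _, None => -1
  | None, None => 0
  end.

Definition bordered_pf (xs : seq K) : K :=
  pfseq bordered_entry (uphalf (size xs)) (nseq (odd (size xs)) None ++ map Some xs).

Lemma bordered_entry_skew a b : bordered_entry a b = - bordered_entry b a.
Proof.
case: a b => [x|] [y|]; rewrite /= ?opprK ?oppr0 // /schur_entry.
rewrite -(opprB y x) !mulNr opprK.
by rewrite (mulrAC _ y x) (mulrAC w y x) [y + x]addrC [y * x]mulrC.
Qed.

Lemma bordered_entry_diag a : bordered_entry a a = 0.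
Proof. by case: a => [x|] //=; rewrite /schur_entry subrr !mul0r. Qed.

Lemma schur_entry0 b : b != 0 -> schur_entry w 0 b = 1.
Proof.
move=> b0; rewrite /schur_entry !(mulr0, mul0r, subr0, add0r, addr0, mulr1).
exact: divff.
Qed.

Lemma schur_entry1 b : b != 1 -> 1 + b + w * b != 0 -> schur_entry w 1 b = -1.
Proof.
move=> b1 b0; rewrite /schur_entry !mulr1 mul1r (mulrDl 1 w) mul1r addrA.
by field; rewrite subr_eq0 eq_sym b1 b0.
Qed.

(** The hypothesis of [partial_fractions] holds because F(z) is a Pfaffian with
    first index z.  For an odd number of variables, the expansion of the bordered
    Pfaffian along its row of ones is the value of F at 0, and the opposite of the
    value at 1.  For an even number the constant [c0] is the term pairing z with
    the border, and the rest of F cancels at 0 and at 1: up to sign it is a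
    Pfaffian with two rows of ones. *)
Lemma bordered_pf_rec xs : generic w xs ->
  altsum (fun b r => (1 - b) * \prod_(y <- r) pick_ratio w y b * bordered_pf r) xs =
  (1 - \prod_(x <- xs) x) * bordered_pf xs.
Proof.
move=> gxs; have [_ x0 _ _] := gxs.
pose m := (size xs)./2.
have vanish a u x : x \in xs -> pfseq bordered_entry a (Some x :: u ++ map Some xs) = 0.
  case/splitPr => l r; rewrite map_cat /= catA.
  by apply: pfseq_repeat => *; [exact: bordered_entry_skew | exact: bordered_entry_diag].
have := odd_double_half (size xs); case odd_xs: (odd (size xs)); rewrite -/m => sxs.
- pose G (r : seq K) := pfseq bordered_entry m (map Some r).
  have pfr b r : perm_eq (b :: r) xs -> bordered_pf r = G r.
    move/perm_size; rewrite -sxs add1n => -[sr].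
    by rewrite /bordered_pf sr uphalf_double odd_double.
  have pfxs : bordered_pf xs = altsum (fun _ r => G r) xs.
    rewrite /bordered_pf -sxs add1n /= doubleK odd_double /= altsum_map.
    by apply: eq_altsum => b r; rewrite mul1r.
  have := @partial_fractions _ w 0 G xs gxs.
  rewrite add0r => PF.
  transitivity (altsum (fun b r => (1 - b) * \prod_(y <- r) pick_ratio w y b * G r) xs).
    by apply: eq_altsum_in => b r pbr _; rewrite (pfr b).
  rewrite PF => [|x xx]; last first.
    by rewrite add0r -[RHS](vanish m.+1 [::] x xx) /= altsum_map.
  have -> : altsum (fun b r => schur_entry w 0 b * G r) xs = bordered_pf xs.
    rewrite pfxs; apply: eq_altsum_in => b r pbr _.
    have /x0[b0 _ _ _] : b \in xs by rewrite -(perm_mem pbr) mem_head.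
    by rewrite schur_entry0 // mul1r.
  have -> : altsum (fun b r => schur_entry w 1 b * G r) xs = - bordered_pf xs.
    rewrite pfxs -altsumN; apply: eq_altsum_in => b r pbr _.
    have /x0[_ b1 _ b0] : b \in xs by rewrite -(perm_mem pbr) mem_head.
    by rewrite schur_entry1 // mulN1r.
  by rewrite -signr_odd odd_xs /=; ring.
pose G (r : seq K) := - pfseq bordered_entry m (None :: map Some r).
have pfr b r : perm_eq (b :: r) xs -> bordered_pf r = - G r.
  move/perm_size => /= sr; rewrite /bordered_pf /G opprK.
  have odd_r : odd (size r) by rewrite -[odd _]negbK -oddS sr odd_xs.
  by rewrite odd_r /= uphalfE sr.
have pfxs : bordered_pf xs = pfseq bordered_entry m (map Some xs).
  by rewrite /bordered_pf -sxs add0n uphalf_double odd_double.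
have FE z : - bordered_pf xs + altsum (fun b r => schur_entry w z b * G r) xs =
    pfseq bordered_entry m.+1 (Some z :: None :: map Some xs).
  rewrite pfxs /= mulN1r; congr (_ + _).
  by rewrite altsum_map -altsumN; apply: eq_altsum => b r; rewrite mulrN.
have G0 : altsum (fun _ r => G r) xs = 0.
  rewrite altsumN /=; apply/eqP; rewrite oppr_eq0; apply/eqP.
  case Dm: m => [|m'] /=; first by rewrite altsum0.
  under eq_altsum => b r do rewrite altsum_map.
  under eq_altsum => b r do under eq_altsum => c r' do rewrite mul1r.
  exact: (altsum_sym (g := fun _ _ r => pfseq bordered_entry m' (map Some r))).
have := @partial_fractions _ w (- bordered_pf xs) G xs gxs.
have -> : altsum (fun b r => schur_entry w 0 b * G r) xs = 0.
  rewrite -[RHS]G0; apply: eq_altsum_in => b r pbr _.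
  have /x0[b0 _ _ _] : b \in xs by rewrite -(perm_mem pbr) mem_head.
  by rewrite schur_entry0 // mul1r.
have -> : altsum (fun b r => schur_entry w 1 b * G r) xs = 0.
  rewrite -[RHS]oppr0 -[in RHS]G0 -altsumN; apply: eq_altsum_in => b r pbr _.
  have /x0[_ b1 _ b0] : b \in xs by rewrite -(perm_mem pbr) mem_head.
  by rewrite schur_entry1 // mulN1r.
rewrite -signr_odd odd_xs => PF.
transitivity (- altsum (fun b r => (1 - b) * \prod_(y <- r) pick_ratio w y b * G r) xs).
  by rewrite -altsumN; apply: eq_altsum_in => b r pbr _; rewrite (pfr b) // mulrN.
rewrite PF => [|x xx]; last by rewrite FE (vanish _ [:: None]).
by ring.
Qed.

Fixpoint pairprod (f : K -> K -> K) (s : seq K) : K :=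
  if s is b :: s' then \prod_(y <- s') f b y * pairprod f s' else 1.

Lemma pairprod_split f u b v : (forall x y, f x y = f y x) ->
  pairprod f (u ++ b :: v) = \prod_(y <- u ++ v) f b y * pairprod f (u ++ v).
Proof.
move=> fC; elim: u => [|c u IH] //=.
rewrite IH !big_cat !big_cons big_cat /= (fC c b); ring.
Qed.

(** The recursion satisfied by the antisymmetrisation L(x); [m] is the length
    of [s]. *)
Fixpoint picking_sum (m : nat) (s : seq K) : K :=
  if m is m'.+1 then
    (1 - \prod_(x <- s) x)^-1 *
    altsum (fun b r => \prod_(y <- r) (y * (1 + y * b + w * b)) * picking_sum m' r) s
  else 1.

Lemma picking_sum_closed xs : generic w xs ->
  (forall r, subseq r xs -> r != [::] -> 1 - \prod_(x <- r) x != 0) ->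
  picking_sum (size xs) xs =
  \prod_(x <- xs) (1 - x)^-1 * pairprod (fun x y => x + y + w * x * y) xs * bordered_pf xs.
Proof.
have [m] := ubnP (size xs); elim: m xs => // m IH xs; rewrite ltnS => sm gxs nz.
case Dxs: xs => [|x0 xs0]; first by rewrite /= !big_nil /bordered_pf /= !mulr1.
have nz0 : 1 - \prod_(x <- xs) x != 0 by rewrite nz // Dxs.
rewrite -Dxs; have -> : size xs = (size xs0).+1 by rewrite Dxs.
rewrite [LHS]/=; apply: (mulfI nz0).
rewrite mulVKf // mulrCA -bordered_pf_rec // -altsumZ.
have [uxs x1 xy0 _] := gxs.
apply: eq_altsum_split => u b v Duv.
set r := u ++ v.
have pbr : perm_eq (b :: r) xs by rewrite Duv perm_sym -cat1s perm_catCA.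
have sr : subseq r xs by rewrite Duv cat_subseq ?subseq_cons.
have bxs : b \in xs by rewrite -(perm_mem pbr) mem_head.
have -> : size xs0 = size r by have := perm_size pbr; rewrite Dxs /= => -[].
have sr_m : (size r < m)%N by apply: leq_trans sm; rewrite -(perm_size pbr).
rewrite (IH r sr_m (subseq_generic sr gxs)); last first.
  by move=> r' r'r; apply: nz; apply: subseq_trans sr.
rewrite -[in RHS](perm_big _ pbr) big_cons /= [in RHS]Duv pairprod_split -/r; last first.
  by move=> x y; rewrite [x + y]addrC mulrAC.
have [_ b1 _ _] := x1 b bxs.
suff -> : \prod_(y <- r) (y * (1 + y * b + w * b)) =
    \prod_(y <- r) (b + y + w * b * y) * \prod_(y <- r) pick_ratio w y b.
  by field; rewrite subr_eq0 eq_sym.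
rewrite -big_split; apply: eq_big_seq => y yr /=.
have yxs : y \in xs by rewrite -(perm_mem pbr) in_cons yr orbT.
have yb := xy0 y b yxs bxs.
rewrite /pick_ratio [b + y]addrC [w * b * y]mulrAC.
by field.
Qed.
End ClosedForm.

(** * The antisymmetrisation as a rational function *)

Definition ord_seq (T : Type) n (x : 'I_n -> T) : seq T := [seq x i | i <- enum 'I_n].

Lemma ord_seqS T n (x : 'I_n.+1 -> T) :
  ord_seq x = x ord0 :: ord_seq (fun i => x (lift ord0 i)).
Proof. by rewrite /ord_seq enum_ordSl /= -map_comp. Qed.

Lemma size_ord_seq T n (x : 'I_n -> T) : size (ord_seq x) = n.
Proof. by rewrite size_map size_enum_ord. Qed.

Lemma prod_ord_seq (K : comPzRingType) T n (x : 'I_n -> T) (f : T -> K) :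
  \prod_(y <- ord_seq x) f y = \prod_i f (x i).
Proof. by rewrite big_map big_enum. Qed.

Lemma pairprod_ord (K : fieldType) (f : K -> K -> K) n (x : 'I_n -> K) :
  \prod_(i < n) \prod_(j < n | (i < j)%N) f (x i) (x j) = pairprod f (ord_seq x).
Proof.
elim: n x => [|n IH] x; first by rewrite big_ord0 /ord_seq enum_ord0.
rewrite ord_seqS big_ord_recl /= -IH prod_ord_seq; congr (_ * _).
  by rewrite big_mkcond big_ord_recl /= mul1r; apply: eq_bigr.
apply: eq_bigr => i _; rewrite big_mkcond big_ord_recl /= mul1r [RHS]big_mkcond /=.
by apply: eq_bigr => j _; rewrite /bump !add1n ltnS.
Qed.

Section Assembly.
Variables (K : fieldType) (w : K).

(** The function which is antisymmetrised: the second factor is the sum of the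
    monomials y^k over all increasing sequences k. *)
Definition gap_weight n (y : 'I_n -> K) : K :=
  (\prod_(i < n) \prod_(j < n | (i < j)%N) (1 * y i * y j + 1 + w * y i)) *
  (\prod_(i < n) y i ^+ i / \prod_(i < n) (1 - \prod_(l < n | (i <= l)%N) y l)).

Lemma gap_weightS n (y : 'I_n.+1 -> K) : gap_weight y =
  (1 - \prod_i y i)^-1 *
  (\prod_(i < n) (y (lift ord0 i) * (1 + y (lift ord0 i) * y ord0 + w * y ord0)) *
   gap_weight (fun i => y (lift ord0 i))).
Proof.
rewrite /gap_weight !(pairprod_ord (fun a b => 1 * a * b + 1 + w * a)) ord_seqS /=.
rewrite prod_ord_seq; set y' := fun i => y (lift ord0 i).
rewrite [\prod_(i < n.+1) y i ^+ i]big_ord_recl expr0 mul1r.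
rewrite [\prod_(i < n.+1) (1 - _)]big_ord_recl /=.
have -> : \prod_(i < n) y (lift ord0 i) ^+ bump 0 i = \prod_i y' i * \prod_i y' i ^+ i.
  by rewrite -big_split; apply: eq_bigr => i _; rewrite exprS.
have -> : \prod_(i < n) (1 - \prod_(l < n.+1 | (bump 0 i <= l)%N) y l) =
          \prod_(i < n) (1 - \prod_(l < n | (i <= l)%N) y' l).
  apply: eq_bigr => i _; congr (1 - _).
  rewrite big_mkcond big_ord_recl /= mul1r [RHS]big_mkcond.
  by apply: eq_bigr => l _; rewrite /= /bump !add1n ltnS.
rewrite big_split /= invfM.
have -> : \prod_(i < n) (y ord0 * y' i + 1 + w * y ord0) =
          \prod_(i < n) (1 + y (lift ord0 i) * y ord0 + w * y ord0).
  by apply: eq_bigr => i _; rewrite [y ord0 * _]mulrC [_ + 1]addrC.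
have -> : \prod_(l < n.+1 | (0 <= l)%N) y l = \prod_l y l by apply: eq_bigl.
by rewrite -/y' mul1r; ring.
Qed.

(** In [gap_weight] the first variable b contributes 1/(1 - prod y), one factor y
    for each later variable, and the factors 1 + b y + w b; the first of
    these contributions does not depend on the order of the variables. *)
Lemma asym_gap_weight n (x : 'I_n -> K) :
  asym (@gap_weight n) x = picking_sum w n (ord_seq x).
Proof.
rewrite /asym; elim: n x => [|n IH] x.
  rewrite (big_pred1 1%g) => [|s]; last by apply/esym/eqP/permP => -[].
  by rewrite odd_perm1 /gap_weight !big_ord0 invr1 !mulr1.
rewrite sum_lift_perm [picking_sum _ _ _]/= altsum_ord big_distrr /=.
apply: eq_bigr => j _; rewrite -/(ord_seq (fun i => x (lift j i))) -IH.
rewrite !prod_ord_seq !big_distrr /=; apply: eq_bigr => s _.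
rewrite gap_weightS lift_perm_id odd_lift_perm addFb signr_addb signr_odd.
have -> : gap_weight (fun i => x (lift_perm ord0 j s (lift ord0 i))) =
          gap_weight (fun i => x (lift j (s i))).
  rewrite /gap_weight; congr (_ * (_ / _)).
  - apply: eq_bigr => i _; apply: eq_bigr => l _; by rewrite !lift_perm_lift.
  - by apply: eq_bigr => i _; rewrite lift_perm_lift.
  - apply: eq_bigr => i _; congr (1 - _).
    by apply: eq_bigr => l _; rewrite lift_perm_lift.
have -> : \prod_i x (lift_perm ord0 j s i) = \prod_i x i.
  by rewrite [RHS](reindex_inj (@perm_inj _ (lift_perm ord0 j s))).
have -> : \prod_i (x (lift_perm ord0 j s (lift ord0 i)) *
      (1 + x (lift_perm ord0 j s (lift ord0 i)) * x j + w * x j)) =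
    \prod_i (x (lift j i) * (1 + x (lift j i) * x j + w * x j)).
  rewrite [RHS](reindex_inj (@perm_inj _ s)).
  by apply: eq_bigr => i _; rewrite lift_perm_lift.
set A := (-1) ^+ j; set B := (-1) ^+ s; ring.
Qed.

Lemma nth_ord_seq (x0 : K) n (x : 'I_n -> K) (i : 'I_n) : nth x0 (ord_seq x) i = x i.
Proof. by rewrite (nth_map i) ?size_enum_ord // nth_ord_enum. Qed.

(** For odd n the index 0 is the border; for even n the indices start at 1 and
    the border is absent. *)
Lemma pfaffian_range_bordered n (x : 'I_n -> K) :
  pfaffian_range (chi_even n) (pf_entry x w) = bordered_pf w (ord_seq x).
Proof.
pose u (k : nat) : option K := if k is k'.+1 then Some (nth 0 (ord_seq x) k') else None.
have Eu a c : (a < c)%N -> (c <= n)%N ->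
    pf_entry x w (inord a) (inord c) = bordered_entry w (u a) (u c).
  have unliftS k (kn : (k < n)%N) :
      unlift ord0 (inord k.+1 : 'I_n.+1) = Some (Ordinal kn).
    rewrite -(liftK ord0 (Ordinal kn)); congr (unlift _ _).
    by apply: val_inj; rewrite /= inordK.
  have uS k (kn : (k < n)%N) : u k.+1 = Some (x (Ordinal kn)).
    by rewrite /u -(nth_ord_seq 0 x (Ordinal kn)).
  case: c => // c ac cn; rewrite /pf_entry (unliftS _ cn) (uS _ cn).
  case: a ac => [|a] ac.
    have -> : inord 0 = ord0 :> 'I_n.+1 by apply: val_inj; rewrite /= inordK.
    by rewrite unlift_none.
  have an : (a < n)%N by apply: ltn_trans cn.
  by rewrite (unliftS _ an) (uS _ an).
have Dn : (chi_even n + (uphalf n).*2 = n.+1)%N.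
  rewrite /chi_even uphalf_half doubleD -[in RHS](odd_double_half n).
  by case: (odd n).
rewrite /pfaffian_range /bordered_pf size_ord_seq.
have -> : ((n.+1 - chi_even n)./2 = uphalf n)%N by rewrite -[in LHS]Dn addKn doubleK.
rewrite (@eq_pfaffian _ _ _ (fun i j : 'I_(uphalf n).*2 =>
    bordered_entry w (u (chi_even n + i)%N) (u (chi_even n + j)%N))); last first.
  by move=> i j ij; apply: Eu; rewrite ?ltn_add2l // -ltnS -Dn ltn_add2l.
rewrite (pfaffian_pfseq (bordered_entry w)
  (fun i : 'I_(uphalf n).*2 => u (chi_even n + i)%N)).
congr (pfseq _ _ _).
rewrite (map_comp u (fun i : 'I__ => chi_even n + i)%N).
rewrite (map_comp (addn (chi_even n)) val) val_enum_ord -iotaDl addn0.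
have uSE : map u (iota 1 n) = map Some (ord_seq x).
  rewrite -[in RHS](mkseq_nth 0 (ord_seq x)) size_ord_seq /mkseq.
  by rewrite -[1%N]addn0 iotaDl -!map_comp.
move: Dn; rewrite -uSE /chi_even; case: (odd n) => /=.
  by rewrite add0n => ->.
by rewrite add1n => -[->].
Qed.

Lemma asym_littlewood n (x : 'I_n -> K) (xs := ord_seq x) : generic w xs ->
  (forall r, subseq r xs -> r != [::] -> 1 - \prod_(y <- r) y != 0) ->
  asym (@gap_weight n) x / \prod_(i < n) \prod_(j < n | (i < j)%N) (x j - x i) =
  littlewood_rhs x w.
Proof.
move=> gx nz; rewrite asym_gap_weight /littlewood_rhs pfaffian_range_bordered.
have := picking_sum_closed gx nz; rewrite size_ord_seq => ->.
rewrite -pairprod_ord prod_ord_seq.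
have -> : \prod_(i < n) \prod_(j < n | (i < j)%N)
    ((x i + x j + w * x i * x j) / (x j - x i)) =
  (\prod_(i < n) \prod_(j < n | (i < j)%N) (x i + x j + w * x i * x j)) /
  \prod_(i < n) \prod_(j < n | (i < j)%N) (x j - x i).
  rewrite -prodf_div; apply: eq_bigr => i _; exact: prodf_div.
ring.
Qed.
End Assembly.

(** * Divisibility by the Vandermonde product *)

(** Write p_j = q_j (X - a) + p_j(a) with a = x_0.  Subtracting the first row from
    the others extracts the factors x_i - a, and the cofactors of the first row
    of what remains are determinants of the same kind for the q_j. *)
Lemma det_poly_vandermonde (A : comNzRingType) n (x : 'I_n -> A) (p : 'I_n -> {poly A}) :
  exists c, \det (\matrix_(i, j) (p j).[x i]) =
            c * \prod_(i < n) \prod_(j < n | (i < j)%N) (x j - x i).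
Proof.
elim: n x p => [|n IH] x p; first by exists 1; rewrite det_mx00 big_ord0 mulr1.
set a := x ord0; pose y i := x (lift ord0 i).
have /fin_all_exists[q pq] j : exists q, p j = q * ('X - a%:P) + ((p j).[a])%:P.
  have /factor_theorem[q Dq] : root (p j - ((p j).[a])%:P) a.
    by rewrite /root hornerD hornerN hornerC subrr.
  by exists q; rewrite -Dq subrK.
pose M := \matrix_(i, j) (if unlift ord0 i is Some i' then (q j).[y i'] else (p j).[a]).
pose B := \matrix_(i < n.+1, k < n.+1)
  (if unlift ord0 i is Some i' then if k == ord0 then 1 else (i == k)%:R * (y i' - a)
   else (k == ord0)%:R : A).
have DM : \matrix_(i, j) (p j).[x i] = B *m M.
  apply/matrixP => i j; rewrite !mxE big_ord_recl !mxE unlift_none eqxx.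
  case: (unliftP ord0 i) => [i'|] ->.
    rewrite (bigD1 i') //= !mxE eq_sym (negPf (neq_lift _ _)) eqxx liftK !mul1r.
    rewrite big1 => [|k ki]; last first.
      rewrite !mxE liftK (inj_eq lift_inj) [i' == k]eq_sym (negPf ki) eq_sym.
      by rewrite (negPf (neq_lift _ _)) !mul0r.
    rewrite addr0 {1}pq hornerD hornerC hornerM hornerXsubC addrC; congr (_ + _).
    exact: mulrC.
  rewrite mul1r big1 ?addr0 // => k _.
  by rewrite !mxE unlift_none eq_sym (negPf (neq_lift _ _)) mul0r.
have detB : \det B = \prod_i (y i - a).
  rewrite det_trig; last first.
    apply/is_trig_mxP => i k ik; rewrite mxE.
    have k0 : k != ord0 by apply: contraTneq ik => ->; rewrite ltn0.
    rewrite (negPf k0); case: (unlift ord0 i) => [i'|] //.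
    by rewrite -val_eqE /= (ltn_eqF ik) mul0r.
  rewrite big_ord_recl mxE unlift_none eqxx mul1r; apply: eq_bigr => i _.
  by rewrite mxE liftK eq_sym (negPf (neq_lift _ _)) eqxx mul1r.
have /fin_all_exists[c Dc] j : exists c, cofactor M ord0 j =
    c * \prod_(i < n) \prod_(l < n | (i < l)%N) (y l - y i).
  have [c Dc] := IH y (fun k => q (lift j k)).
  exists ((-1) ^+ ((ord0 : 'I_n.+1) + j) * c); rewrite -mulrA -Dc; congr (_ * \det _).
  by apply/matrixP => i k; rewrite !mxE liftK.
exists (\sum_j M ord0 j * c j).
have detM : \det M = (\sum_j M ord0 j * c j) *
    \prod_(i < n) \prod_(l < n | (i < l)%N) (y l - y i).
  rewrite (expand_det_row _ ord0) mulr_suml.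
  by apply: eq_bigr => j _; rewrite Dc mulrA.
rewrite DM det_mulmx detB detM mulrCA; congr (_ * _); rewrite big_ord_recl; congr (_ * _).
  by rewrite [RHS]big_mkcond big_ord_recl /= mul1r.
apply: eq_bigr => i _; rewrite [RHS]big_mkcond big_ord_recl /= mul1r big_mkcond.
by apply: eq_bigr => l _; rewrite /= /bump !add1n ltnS.
Qed.

Section Alternants.
Variables (R : idomainType) (n : nat).
Local Notation MP := {mpoly R[n]}.
Implicit Types (p q h : MP) (m : 'X_{1..n}).

Definition alternant (h : MP) : MP := \sum_(s : 'S_n) (-1) ^+ s * msym s h.

Definition vandermonde_prod : MP := \prod_(i < n) \prod_(j < n | (i < j)%N) ('X_j - 'X_i).

Lemma alternantB : {morph alternant : p q / p - q}.
Proof.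
move=> p q; rewrite /alternant -sumrB; apply: eq_bigr => s _.
by rewrite msymB mulrBr.
Qed.

Lemma alternant_sum (I : Type) (r : seq I) (F : I -> MP) :
  alternant (\sum_(i <- r) F i) = \sum_(i <- r) alternant (F i).
Proof.
rewrite /alternant exchange_big; apply: eq_bigr => s _.
by rewrite raddf_sum big_distrr.
Qed.

Lemma alternant_symM q h : (forall s, msym s q = q) -> alternant (q * h) = q * alternant h.
Proof.
move=> qs; rewrite /alternant big_distrr; apply: eq_bigr => s _.
by rewrite msymM qs mulrCA.
Qed.

Lemma msym_var (s : 'S_n) i : msym s ('X_i : MP) = 'X_(s i).
Proof.
rewrite msymX; congr 'X_[_]; apply/mnmP => j; rewrite !mnmE.
by rewrite -(inj_eq (@perm_inj _ s)) permKV.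
Qed.

(** By linearity it suffices to treat monomials, whose alternants are determinants
    of powers. *)
Lemma alternant_dvd h : exists q, alternant h == q * vandermonde_prod.
Proof.
have mono m : exists q, alternant 'X_[m] = q * vandermonde_prod.
  have [c Dc] := det_poly_vandermonde (fun i => 'X_i : MP) (fun j => 'X^(m j)).
  exists c; rewrite -[RHS]Dc -det_tr /alternant; apply: eq_bigr => s _.
  congr (_ * _); rewrite mpolyXE_id rmorph_prod; apply: eq_bigr => i _.
  by rewrite !mxE hornerXn rmorphXn /= msym_var.
have [c Dc] : exists c : 'X_{1..n} -> MP,
    forall m, alternant 'X_[m] = c m * vandermonde_prod.
  have mono' m : exists q, alternant 'X_[m] == q * vandermonde_prod.
    by have [q ->] := mono m; exists q.
  by exists (fun m => xchoose (mono' m)) => m; exact/eqP/(xchooseP (mono' m)).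
exists (\sum_(m <- msupp h) h@_m *: c m).
rewrite [h in alternant h]mpolyE alternant_sum big_distrl /=.
apply/eqP/eq_bigr => m _; rewrite -scalerAl -Dc /alternant scaler_sumr.
by apply: eq_bigr => s _; rewrite msymZ scalerAr.
Qed.

Definition divided h : MP := xchoose (alternant_dvd h).

Lemma dividedE h : divided h * vandermonde_prod = alternant h.
Proof. by have /eqP := xchooseP (alternant_dvd h). Qed.

Definition order_ge (N : nat) p := forall m, (mdeg m < N)%N -> p@_m = 0.

Lemma order_geW N M p : (M <= N)%N -> order_ge N p -> order_ge M p.
Proof. by move=> MN pN m mM; apply: pN; apply: leq_trans MN. Qed.

Lemma order_geB N p q : order_ge N p -> order_ge N q -> order_ge N (p - q).
Proof. by move=> pN qN m mN; rewrite mcoeffB pN // qN // subrr. Qed.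

Lemma order_geM N M p q : order_ge N p -> order_ge M q -> order_ge (N + M) (p * q).
Proof.
move=> pN qM m mNM; rewrite mcoeffM big1 // => -[k1 k2] /= /eqP Dm.
have [k1N|k1N] := ltnP (mdeg k1) N; first by rewrite pN ?mul0r.
rewrite qM ?mulr0 // -(ltn_add2l (mdeg k1)) -mdegD -Dm.
by apply: leq_trans mNM _; rewrite leq_add2r.
Qed.

Lemma order_geMl N p q : order_ge N p -> order_ge N (p * q).
Proof. by move=> pN; rewrite -[N]addn0; apply: order_geM. Qed.

Lemma order_geX N p k : order_ge N p -> order_ge (k * N) (p ^+ k).
Proof.
by move=> pN; elim: k => [|k IH] //; rewrite exprS mulSn; apply: order_geM.
Qed.

Lemma order_ge_var i : order_ge 1 ('X_i : MP).
Proof.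
move=> m; rewrite ltnS leqn0 mdeg_eq0 => /eqP ->.
by rewrite mcoeffX -mdeg_eq0 mdeg1.
Qed.

Lemma order_ge_alternant N h : order_ge N h -> order_ge N (alternant h).
Proof.
move=> hN m mN; rewrite /alternant raddf_sum big1 // => s _ /=.
by rewrite mulr_sign; case: ifP => _; rewrite ?mcoeffN mcoeff_sym hN ?oppr0 ?mdeg_mperm.
Qed.

(** The coefficient of p at m equals the one at m + U_j - U_i, by comparing the
    coefficients of the product at m + U_j.  Iterating exhausts the exponent m_i,
    after which the coefficient is 0. *)
Lemma order_ge_diffK N p i j : i != j ->
  order_ge N.+1 (p * ('X_j - 'X_i)) -> order_ge N p.
Proof.
move=> ij pN m; have [k] := ubnP (m i); elim: k m => // k IH m; rewrite ltnS => mi mN.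
have := pN (m + U_(j))%MM; rewrite mdegD mdeg1 addn1 ltnS => /(_ mN).
rewrite mulrBr mcoeffB {1}[(m + _)%MM]addmC mcoeffMX => /subr0_eq ->.
have [mi0|mi0] := eqVneq (m i) 0%N.
  rewrite mcoeffM big1 // => -[k1 k2] /= /eqP/mnmP/(_ i).
  rewrite !mnmE mi0 eq_sym (negPf ij) => /esym/eqP; rewrite addn_eq0 => /andP[_ /eqP k20].
  rewrite mcoeffX; case: eqP => [Dk|]; rewrite ?mulr0 //.
  by move: k20; rewrite -Dk mnmE eqxx.
have Dm : (m + U_(j) = (m - U_(i) + U_(j)) + U_(i))%MM.
  by rewrite -addmA [(U_(j) + _)%MM]addmC addmA submK // lep1mP.
rewrite Dm addmC mcoeffMX IH //.
  rewrite !mnmE eqxx eq_sym (negPf ij) addn0 subn1.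
  by apply: leq_trans mi; rewrite prednK // lt0n.
move/(congr1 mdeg): Dm; rewrite !mdegD !mdeg1 => /addIn <-.
exact: mN.
Qed.

Definition pair_count := #|[set ij : 'I_n * 'I_n | (ij.1 < ij.2)%N]|.

Lemma order_ge_vandermondeK N p :
  order_ge (N + pair_count) (p * vandermonde_prod) -> order_ge N p.
Proof.
rewrite /vandermonde_prod pair_big_dep /= /pair_count cardE.
have -> : \prod_(ij : 'I_n * 'I_n | (ij.1 < ij.2)%N) ('X_ij.2 - 'X_ij.1 : MP) =
  \prod_(ij <- enum [set ij : 'I_n * 'I_n | (ij.1 < ij.2)%N]) ('X_ij.2 - 'X_ij.1).
  by rewrite big_enum; apply: eq_bigl => ij; rewrite inE.
have : {in enum [set ij : 'I_n * 'I_n | (ij.1 < ij.2)%N], forall ij, ij.1 != ij.2}.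
  by move=> ij; rewrite mem_enum inE -val_eqE => /ltn_eqF ->.
elim: (enum _) N p => [|[i j] l IH] N p ne /=; first by rewrite big_nil mulr1 addn0.
rewrite big_cons addnS -addSn mulrA => pN.
apply: (@order_ge_diffK _ _ i j); first by apply: (ne (i, j)); rewrite mem_head.
by apply: (IH _ _ _ pN) => kl kll; apply: ne; rewrite in_cons kll orbT.
Qed.

Lemma order_ge_divided N h : order_ge (N + pair_count) h -> order_ge N (divided h).
Proof.
by move=> hN; apply: order_ge_vandermondeK; rewrite dividedE; apply: order_ge_alternant.
Qed.
End Alternants.

(** * Increasing sequences and their gaps *)

Section Gaps.
Variable n : nat.

(** [a 0] is the first term and [a i] the number of integers skipped before the
    term of rank i. *)
Definition of_gaps (a : 'I_n -> nat) : n.-tuple nat :=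
  [tuple (i + \sum_(l < n | (l <= i)%N) a l)%N | i < n].

(** The increasing sequences with all gaps less than M.  Unlike a bound on the
    terms, a bound on the gaps makes the generating function a product. *)
Definition gap_box (M : nat) : seq (n.-tuple nat) :=
  [seq of_gaps (fun i => val (a i)) |
     a : {ffun 'I_n -> 'I_M} <- enum {ffun 'I_n -> 'I_M}].

Lemma of_gaps_inj a b : of_gaps a = of_gaps b -> a =1 b.
Proof.
move=> /(congr1 (@tnth _ _)) ab i; have [k] := ubnP (i : nat).
elim: k i => // k IH i; rewrite ltnS => ik.
have := congr1 (fun f => f i) ab; rewrite !tnth_mktuple => /addnI.
rewrite (bigD1 i) //= [X in _ = X](bigD1 i) //=.
set u := bigop _ _ _; set v := bigop _ _ _.
suff -> : u = v by move/addIn.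
apply: eq_bigr => l /andP[li l_i]; apply: IH.
by apply: leq_trans ik; rewrite ltn_neqAle val_eqE l_i li.
Qed.

Lemma gap_box_uniq M : uniq (gap_box M).
Proof.
rewrite map_inj_uniq ?enum_uniq // => a b /of_gaps_inj ab.
by apply/ffunP => i; apply/val_inj/ab.
Qed.

Lemma of_gaps_sorted a : sorted ltn (of_gaps a).
Proof.
apply/(sortedP 0%N) => i; rewrite size_tuple => iS.
have i_n : (i < n)%N by apply: ltnW.
have -> : nth 0%N (of_gaps a) i = tnth (of_gaps a) (Ordinal i_n).
  by rewrite (tnth_nth 0%N).
have -> : nth 0%N (of_gaps a) i.+1 = tnth (of_gaps a) (Ordinal iS).
  by rewrite (tnth_nth 0%N).
rewrite !tnth_mktuple /= addSn ltnS leq_add2l.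
rewrite [X in (_ <= X)%N](bigID (fun l : 'I_n => (l <= i)%N)) /=.
apply: leq_trans (leq_addr _ _); rewrite big_mkcond [X in (_ <= X)%N]big_mkcond /=.
apply: leq_sum => l _; case: (leqP l i) => // li.
by rewrite leqW.
Qed.

Lemma gap_box_sorted M : all (fun k : n.-tuple nat => sorted ltn k) (gap_box M).
Proof. by apply/allP => _ /mapP[a _ ->]; exact: of_gaps_sorted. Qed.

Lemma mem_gap_box M (k : n.-tuple nat) : sorted ltn k ->
  (forall i, (tnth k i < M)%N) -> k \in gap_box M.
Proof.
move=> sk kM; pose K := nth 0%N k.
have KE (i : 'I_n) : K i = tnth k i by rewrite (tnth_nth 0%N).
pose A i := if i is i'.+1 then (K i - (K i').+1)%N else K 0%N.
have AM (i : 'I_n) : (A i < M)%N.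
  apply: leq_ltn_trans (kM i); rewrite -KE; case: (i : nat) => //= j.
  exact: leq_subr.
have sumA i : (i < n)%N -> (i + \sum_(l < i.+1) A l = K i)%N.
  elim: i => [|i IH] iS; first by rewrite big_ord_recl big_ord0 addn0.
  rewrite big_ord_recr /= addnA addSn IH 1?ltnW // subnKC //.
  by apply: (elimT (sortedP 0%N) sk); rewrite size_tuple.
apply/mapP; exists [ffun i => Ordinal (AM i)]; first by rewrite mem_enum.
apply: eq_from_tnth => i; rewrite tnth_mktuple -KE -sumA //; congr (_ + _)%N.
rewrite (big_ord_widen n A) //; apply: eq_big => l; rewrite ?ltnS // => _.
by rewrite ffunE.
Qed.

Lemma gap_box_coord M (k : n.-tuple nat) :
  sorted ltn k -> k \notin gap_box M -> exists i, (M <= tnth k i)%N.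
Proof.
move=> sk; have [/existsP //|/existsPn lt_kM] := boolP [exists i, (M <= tnth k i)%N].
by rewrite mem_gap_box // => i; rewrite ltnNge lt_kM.
Qed.

Lemma gap_boxS M M' : (M <= M')%N -> {subset gap_box M <= gap_box M'}.
Proof.
move=> MM _ /mapP[a _ ->]; apply/mapP.
exists [ffun i => widen_ord MM (a i)]; first by rewrite mem_enum.
apply: eq_from_tnth => i; rewrite !tnth_mktuple; congr (_ + _)%N.
by apply: eq_bigr => l _; rewrite ffunE.
Qed.

(** The gap [a i] shifts all terms of rank at least i, so it contributes the power
    [a i] of the product of the x_l with l >= i. *)
Lemma sum_gap_box (A : comNzRingType) (x : 'I_n -> A) M :
  \sum_(k <- gap_box M) \prod_i x i ^+ tnth k i =
  \prod_i x i ^+ i * \prod_(i < n) \sum_(j < M) (\prod_(l < n | (i <= l)%N) x l) ^+ j.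
Proof.
rewrite bigA_distr_bigA big_distrr big_map big_enum /=; apply: eq_bigr => a _.
under eq_bigr do rewrite tnth_mktuple exprD.
rewrite big_split /=; congr (_ * _).
under [RHS]eq_bigr do rewrite -prodrXl.
under eq_bigr do rewrite -prodrXr.
rewrite (exchange_big_dep xpredT) //=.
Qed.
End Gaps.

Lemma sum_gap_box_stable n (V : nmodType) (F : n.-tuple nat -> V) M M' : (M <= M')%N ->
  (forall k : n.-tuple nat, sorted ltn k -> k \notin gap_box n M -> F k = 0) ->
  \sum_(k <- gap_box n M) F k = \sum_(k <- gap_box n M') F k.
Proof.
move=> MM F0; rewrite [RHS](bigID (fun k : n.-tuple nat => k \in gap_box n M)) /=.
rewrite [X in _ + X]big1_seq ?addr0.
  rewrite -[RHS]big_filter; apply/perm_big/uniq_perm; rewrite ?filter_uniq ?gap_box_uniq //.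
  move=> k; rewrite mem_filter; case kM: (k \in gap_box n M) => //=.
  by rewrite (gap_boxS MM kM).
by move=> k /andP[kM kM']; apply: F0 => //; exact: (allP (gap_box_sorted _ _) _ kM').
Qed.

(** * Power series *)

Lemma fps_mul_mpoly n (R : comNzRingType) (p q : {mpoly R[n]}) m :
  fps_mul (fps_of_mpoly p) (fps_of_mpoly q) m = (p * q)@_m.
Proof. by symmetry; apply: mcoeff_poly_mul_lin. Qed.

Section Series.
Variable n : nat.
Local Notation MP := {mpoly {poly int}[n]}.
Local Notation F := (@tofrac MP).

Definition mpoly_w : MP := ('X : {poly int})%:MP.
(** Written as a specialisation of the factors u x_i x_j + v + w x_i at u = v = 1. *)
Definition crossing : MP :=
  \prod_(i < n) \prod_(j < n | (i < j)%N) (1 * 'X_i * 'X_j + 1 + mpoly_w * 'X_i).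
Definition staircase : MP := \prod_(i < n) 'X_i ^+ i.
Definition tails : MP := \prod_(i < n) (1 - \prod_(l < n | (i <= l)%N) 'X_l).
(** Symmetrising the denominators 1 - x_i ... x_n lets the common denominator pass
    through the antisymmetrisation. *)
Definition tails_sym : MP := \prod_(s : 'S_n) msym s tails.
Definition tails_rest : MP := \prod_(s : 'S_n | s != 1%g) msym s tails.

Lemma tails_symE : tails_sym = tails * tails_rest.
Proof. by rewrite /tails_sym (bigD1 1%g) //= msym1m. Qed.

Lemma msym_tails_sym t : msym t tails_sym = tails_sym.
Proof.
rewrite /tails_sym rmorph_prod [RHS](reindex_inj (mulIg t)) /=.
by apply: eq_bigr => s _; rewrite msymMm.
Qed.

Lemma msym_mpoly_w (s : 'S_n) : msym s mpoly_w = mpoly_w.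
Proof. by rewrite /mpoly_w /msym mmapC. Qed.

Lemma tofrac_vandermonde :
  F (vandermonde_prod _ n) =
  \prod_(i < n) \prod_(j < n | (i < j)%N) (@var_x n j - @var_x n i).
Proof.
rewrite rmorph_prod; apply: eq_bigr => i _; rewrite rmorph_prod.
by apply: eq_bigr => j _; rewrite rmorphB.
Qed.

Lemma tofrac_crossing (s : 'S_n) : F (msym s crossing) =
  \prod_(i < n) \prod_(j < n | (i < j)%N)
     (1 * var_x (s i) * var_x (s j) + 1 + var_w n * var_x (s i)).
Proof.
rewrite rmorph_prod [LHS]rmorph_prod; apply: eq_bigr => i _.
rewrite rmorph_prod [LHS]rmorph_prod; apply: eq_bigr => j _.
by rewrite /= !(msymD, msymM, msym1, msym_var, msym_mpoly_w) !(tofracD, tofracM, tofrac1).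
Qed.

Lemma tofrac_power (s : 'S_n) (k : 'I_n -> nat) :
  F (msym s (\prod_i 'X_i ^+ k i)) = \prod_i var_x (s i) ^+ k i.
Proof.
rewrite rmorph_prod [LHS]rmorph_prod; apply: eq_bigr => i _.
by rewrite !rmorphXn /= msym_var.
Qed.

Lemma tofrac_tails (s : 'S_n) : F (msym s tails) =
  \prod_(i < n) (1 - \prod_(l < n | (i <= l)%N) var_x (s l)).
Proof.
rewrite rmorph_prod [LHS]rmorph_prod; apply: eq_bigr => i _.
rewrite !rmorphB !rmorph1 rmorph_prod [X in _ - X]rmorph_prod.
by congr (1 - _); apply: eq_bigr => l _ /=; rewrite msym_var.
Qed.

Lemma asym_tofrac (f : ('I_n -> ratfun n) -> ratfun n) h :
  (forall s : 'S_n, f (fun i => var_x (s i)) = F (msym s h)) ->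
  asym f (@var_x n) = F (alternant h).
Proof.
move=> fh; rewrite /asym /alternant rmorph_sum; apply: eq_bigr => s _.
by rewrite fh rmorphM rmorph_sign.
Qed.

Lemma tofrac_neq0 (p : MP) m : p@_m != 0 -> F p != 0.
Proof. by rewrite tofrac_eq0; apply: contraNneq => ->; rewrite mcoeff0. Qed.

Lemma vandermonde_neq0 : F (vandermonde_prod _ n) != 0.
Proof.
rewrite tofrac_vandermonde; apply/prodf_neq0 => i _; apply/prodf_neq0 => j ij.
rewrite -rmorphB; apply: (@tofrac_neq0 _ U_(j)%MM).
have /negPf ne_ij : i != j by rewrite -val_eqE neq_ltn ij.
by rewrite mcoeffB !mcoeffXU eqxx ne_ij subr0 oner_neq0.
Qed.

Lemma var0 i : ('X_i : MP)@_0%MM = 0.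
Proof. by apply: order_ge_var; rewrite mdeg0. Qed.

Lemma tails_sym0 : tails_sym@_0%MM = 1.
Proof.
rewrite /tails_sym rmorph_prod big1 // => s _ /=.
rewrite mcoeff_sym; have -> : [multinom (0%MM : 'X_{1..n}) (s i) | i < n] = 0%MM.
  by apply/mnmP => i; rewrite !mnmE.
rewrite rmorph_prod big1 // => i _; rewrite rmorphB rmorph1 rmorph_prod /=.
by rewrite (bigD1 i) //= var0 mul0r subr0.
Qed.

Lemma generic_vars : generic (var_w n) (ord_seq (@var_x n)).
Proof.
have memx y : y \in ord_seq (@var_x n) -> exists i, y = F 'X_i.
  by case/mapP => i _ ->; exists i.
split.
- rewrite map_inj_uniq ?enum_uniq // => i j /eqP; rewrite /var_x tofrac_eq => /eqP.
  move/(congr1 (mcoeff U_(j))); rewrite !mcoeffXU eqxx.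
  by case: eqP => // _ /eqP; rewrite eq_sym oner_eq0.
- move=> _ /memx[i ->]; rewrite /var_w -[1]/(F 1); split.
  + by apply: (@tofrac_neq0 _ U_(i)%MM); rewrite mcoeffXU eqxx oner_neq0.
  + rewrite -subr_eq0 -rmorphB; apply: (@tofrac_neq0 _ 0%MM).
    by rewrite rmorphB rmorph1 /= var0 sub0r oppr_eq0 oner_neq0.
  + rewrite -rmorphM -rmorphD; apply: (@tofrac_neq0 _ 0%MM).
    by rewrite rmorphD rmorph1 rmorphM /= var0 mulr0 addr0 oner_neq0.
  + rewrite -rmorphM -!rmorphD; apply: (@tofrac_neq0 _ 0%MM).
    by rewrite !rmorphD rmorph1 rmorphM /= var0 mulr0 !addr0 oner_neq0.
- move=> _ _ /memx[i ->] /memx[j ->]; rewrite /var_w -!rmorphM -!rmorphD.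
  apply: (@tofrac_neq0 _ U_(i)%MM); rewrite !mcoeffD !mcoeffXU eqxx.
  rewrite (@order_geM _ _ 1 1) ?addr0; last by rewrite mdeg1.
  - apply/eqP => /(congr1 (fun p : {poly int} => p.[0])).
    by case: (j == i); rewrite hornerD ?mulr0n !hornerC.
  - by rewrite -[X in order_ge X]add0n; apply: order_geM => //; exact: order_ge_var.
  - exact: order_ge_var.
- move=> _ _ /memx[i ->] /memx[j ->]; rewrite -[1]/(F 1) -rmorphM -rmorphB.
  apply: (@tofrac_neq0 _ 0%MM).
  by rewrite rmorphB rmorph1 rmorphM /= var0 mul0r subr0 oner_neq0.
Qed.

(** A non-empty product of variables has no constant term. *)
Lemma tail_products_neq1 (r : seq (ratfun n)) :
  subseq r (ord_seq (@var_x n)) -> r != [::] -> 1 - \prod_(y <- r) y != 0.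
Proof.
move=> /mem_subseq rx r0.
have [p Dp p0] : exists2 p : MP, \prod_(y <- r) y = F p & p@_0%MM = 0.
  case: r r0 rx => // y r _ rx.
  have /mapP[i _ ->] := rx y (mem_head _ _).
  have {rx} : {subset r <= ord_seq (@var_x n)} by move=> z zr; rewrite rx // in_cons zr orbT.
  rewrite big_cons => rx.
  suff [q ->] : exists q : MP, \prod_(y <- r) y = F q.
    by exists ('X_i * q); rewrite ?rmorphM //= var0 mul0r.
  elim: r rx => [|z r IH] rx; first by exists 1; rewrite big_nil rmorph1.
  have /mapP[j _ ->] := rx z (mem_head _ _).
  have [|q Dq] := IH; first by move=> u ur; rewrite rx // in_cons ur orbT.
  by exists ('X_j * q); rewrite big_cons Dq rmorphM.
rewrite Dp -[1]/(F 1) -rmorphB; apply: (@tofrac_neq0 _ 0%MM).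
by rewrite rmorphB rmorph1 /= p0 subr0 oner_neq0.
Qed.

Definition robbins_mpoly (k : n.-tuple nat) : MP :=
  divided (crossing * \prod_i 'X_i ^+ tnth k i).

Definition littlewood_num : MP := divided (crossing * (tails_rest * staircase)).

Lemma robbins_tofrac (k : n.-tuple nat) :
  robbins (fun i => (tnth k i)%:Z) (@var_x n) 1 1 (var_w n) = F (robbins_mpoly k).
Proof.
rewrite /robbins -tofrac_vandermonde.
rewrite (asym_tofrac (h := crossing * \prod_i 'X_i ^+ tnth k i)).
  by rewrite -dividedE rmorphM mulfK ?vandermonde_neq0.
by move=> s; rewrite msymM tofracM tofrac_crossing tofrac_power.
Qed.

Lemma littlewood_tofrac :
  littlewood_rhs (@var_x n) (var_w n) = F littlewood_num / F tails_sym.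
Proof.
rewrite -(asym_littlewood generic_vars tail_products_neq1) -tofrac_vandermonde.
have Q0 : F tails_sym != 0 by apply: (@tofrac_neq0 _ 0%MM); rewrite tails_sym0 oner_neq0.
apply: (canLR (mulfK vandermonde_neq0)); apply: (mulIf Q0).
rewrite mulrAC divfK // -rmorphM dividedE /asym /alternant rmorph_sum big_distrl.
apply: eq_bigr => s _; rewrite /= rmorphM rmorph_sign -mulrA; congr (_ * _).
rewrite /gap_weight -tofrac_crossing -(tofrac_power s (fun i => i)) -tofrac_tails.
have t0 : F (msym s tails) != 0.
  apply: contraNneq Q0; rewrite -(msym_tails_sym s) tails_symE rmorphM rmorphM /= => ->.
  by rewrite mul0r.
have cancel (K : fieldType) (c st t r : K) : t != 0 ->
    c * (st / t) * (t * r) = c * (r * st) by move=> ?; field.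
rewrite -[tails_sym](msym_tails_sym s) tails_symE !msymM /= !tofracM.
exact: cancel.
Qed.

Lemma order_ge_monomial (k : n.-tuple nat) i :
  order_ge (tnth k i) (\prod_j 'X_j ^+ tnth k j : MP).
Proof.
rewrite (bigD1 i) //=; apply: order_geMl; rewrite -[X in order_ge X _]muln1.
by apply: order_geX; exact: order_ge_var.
Qed.

(** Outside the box some exponent of x^k is large, hence x^k has high order, and
    the division by the Vandermonde product loses at most one per factor. *)
Lemma robbins_mpoly_vanish (k : n.-tuple nat) N m : sorted ltn k ->
  (mdeg m < N)%N -> k \notin gap_box n (N + pair_count n) -> (robbins_mpoly k)@_m = 0.
Proof.
move=> sk mN /(gap_box_coord sk)[i ki]; apply: order_ge_divided mN.
rewrite mulrC; apply: order_geMl; apply: order_geW ki _; exact: order_ge_monomial.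
Qed.

(** The left factor turns each truncated geometric series in y = x_i ... x_n into
    1 - y^M. *)
Lemma tails_gap_box M :
  order_ge M (tails * \sum_(k <- gap_box n M) \prod_i 'X_i ^+ tnth k i - staircase : MP).
Proof.
rewrite sum_gap_box -/staircase mulrCA -[X in _ - X]mulr1 -mulrBr mulrC.
apply: order_geMl; rewrite -big_split /=.
elim/big_rec: _ => [|i p _ pM]; first by rewrite subrr => m _; rewrite mcoeff0.
set y := \prod_(_ < n | _) _.
have -> : (1 - y) * \sum_(j < M) y ^+ j = 1 - y ^+ M.
  by rewrite -[RHS]opprB subrX1 -mulNr opprB.
have -> : (1 - y ^+ M) * p - 1 = (p - 1) - y ^+ M * p by ring.
apply: order_geB => //; apply: order_geMl; rewrite -[X in order_ge X]muln1.
apply: order_geX; rewrite /y (bigD1 i) //=; apply: order_geMl; exact: order_ge_var.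
Qed.

(** Multiply by the Vandermonde product: the difference becomes the alternant of
    [crossing * tails_rest] times the difference of [tails_gap_box]. *)
Lemma tails_sym_truncation N :
  order_ge N (tails_sym * \sum_(k <- gap_box n (N + pair_count n)) robbins_mpoly k
              - littlewood_num).
Proof.
set M := (N + _)%N; apply: order_ge_vandermondeK.
rewrite mulrBl dividedE -mulrA big_distrl /=.
under eq_bigr do rewrite dividedE.
rewrite -alternant_sum -alternant_symM; last exact: msym_tails_sym.
rewrite -alternantB -big_distrr /=; apply: order_ge_alternant.
have -> : tails_sym * (crossing * \sum_(k <- gap_box n M) \prod_i 'X_i ^+ tnth k i)
    - crossing * (tails_rest * staircase) =
  (tails * (\sum_(k <- gap_box n M) \prod_i 'X_i ^+ tnth k i) - staircase)
    * (crossing * tails_rest).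
  by rewrite tails_symE; ring.
by apply: order_geMl; exact: tails_gap_box.
Qed.

Definition series_cut (m : 'X_{1..n}) : nat := ((mdeg m).+1 + pair_count n)%N.

(** At m the sum is cut at the box beyond which all contributions to the
    coefficient of m vanish. *)
Definition littlewood_series : fps n {poly int} :=
  fun m => \sum_(k <- gap_box n (series_cut m)) (robbins_mpoly k)@_m.

Lemma fps_mul_littlewood_series m :
  fps_mul (fps_of_mpoly tails_sym) littlewood_series m = littlewood_num@_m.
Proof.
pose r := \sum_(k <- gap_box n (series_cut m)) robbins_mpoly k.
transitivity (fps_mul (fps_of_mpoly tails_sym) (fps_of_mpoly r) m).
  apply: eq_bigr => d dm; congr (_ * _).
  rewrite /fps_of_mpoly /r raddf_sum /=.
  apply: sum_gap_box_stable => [|k sk]; last exact: robbins_mpoly_vanish.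
  by rewrite leq_add2r ltnS mdegB.
rewrite fps_mul_mpoly; apply: subr0_eq; rewrite -mcoeffB.
exact: tails_sym_truncation.
Qed.
End Series.

Theorem theorem1p1 (n : nat) (hn : (0 < n)%N) :
  exists (T : n.-tuple nat -> fps n {poly int}) (S : fps n {poly int}),
    [/\ forall k : n.-tuple nat, sorted ltn k ->
          expands_to
            (robbins (fun i => (tnth k i)%:Z) (@var_x n) 1 1 (var_w n)) (T k),
        fps_sum_is (fun k : n.-tuple nat => sorted ltn k) T S &
        expands_to (littlewood_rhs (@var_x n) (var_w n)) S].
Proof.
exists (fun k => fps_of_mpoly (robbins_mpoly k)), (@littlewood_series n); split.
- move=> k _; exists (robbins_mpoly k), 1; split.
  + by rewrite mcoeff1 eqxx unitr1.
  + by rewrite robbins_tofrac rmorph1 divr1.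
  + by move=> m; rewrite fps_mul_mpoly mul1r.
- move=> m; exists (gap_box n (series_cut m)); split => //.
  + exact: gap_box_uniq.
  + exact: gap_box_sorted.
  + by move=> k sk; apply: robbins_mpoly_vanish.
- exists (littlewood_num n), (tails_sym n); split.
  + by rewrite tails_sym0 unitr1.
  + exact: littlewood_tofrac.
  + exact: fps_mul_littlewood_series.
Qed.
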